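(* Let $(\mu;\nu)$ be a bipartition of $n\ge 1$ and let $\Lambda_{(r_i),I}$ be the enhanced quiver variety attached to $(\mu;\nu)$ (defined in the context). If $\Lambda_{(r_i),I}$ is a normal variety, then the closure $\overline{\mathcal{O}_{\mu;\nu}}$ of the enhanced nilpotent orbit $\mathcal{O}_{\mu;\nu}\subset \mathbb{C}^n\times\mathcal{N}_{\mathbb{C}^n}$ is a normal variety.
   Context: A bipartition of $n$ is an ordered pair $(\mu;\nu)$ of partitions with $|\mu|+|\nu|=n$. For a finite-dimensional complex vector space $V$, $\mathcal{N}_V$ denotes the variety of nilpotent endomorphisms of $V$; $GL(V)$ acts on $V\times\mathcal{N}_V$ by $g\cdot(v,x)=(gv,gxg^{-1})$. For a bipartition $(\mu;\nu)$ of $\dim V$, $\mathcal{O}_{\mu;\nu}$ is the set of $(v,x)\in V\times\mathcal{N}_V$ for which there is a basis $\{e_{i,j}: i\ge 1,\ 1\le j\le \mu_i+\nu_i\}$ of $V$ with $xe_{i,j}=e_{i,j-1}$ (where $e_{i,0}=0$) and $v=\sum_{i:\mu_i>0}e_{i,\mu_i}$; these sets are exactly the $GL(V)$-orbits in $V\times\mathcal{N}_V$. Enhanced quiver variety: given the bipartition $(\mu;\nu)$ of $n$, let $\lambda=\mu+\nu$ (termwise sum), $t=\lambda_1$, and $r_i=\lambda^{\mathbf t}_{t-i}$ for $0\le i\le t-1$ (where $\lambda^{\mathbf t}$ is the transpose partition), so $0<r_0\le r_1\le\cdots\le r_{t-1}$ are the column lengths of $\lambda$ in increasing order. Let $I\subset\{0,\dots,t-1\}$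 be the unique subset such that $(r_i)_{i\in I}$ are the column lengths of $\mu$ (in non-decreasing order) and such that $r_i=r_{i+1}$ and $i+1\in I$ imply $i\in I$; let $\bar I=\{0,\dots,t-1\}\setminus I$. Let $U_i=\mathbb{C}^{r_0+\cdots+r_{i-1}}$ for $0\le i\le t$ (so $U_0=0$, $U_t=\mathbb{C}^n$). Then $\Lambda_{(r_i),I}$ is the affine variety of tuples $(u_0,\dots,u_t,A_0,\dots,A_{t-1},B_0,\dots,B_{t-1})$ with $u_i\in U_i$, $A_i\in\mathrm{Hom}(U_i,U_{i+1})$, $B_i\in\mathrm{Hom}(U_{i+1},U_i)$, satisfying $B_iA_i=A_{i-1}B_{i-1}$ for $1\le i\le t-1$, $B_iu_{i+1}=u_i$ for $i\in I$, and $A_iu_i=u_{i+1}$ for $i\in\bar I$. *)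

(* Defs.v *)
(* the ground field C is modelled as R[i] (complex numbers
   over an arbitrary model R of the real numbers, R : realType). *)
From mathcomp Require Import all_boot all_algebra.
From mathcomp Require Import reals.
From mathcomp Require Import complex.
Set Implicit Arguments. Unset Strict Implicit. Unset Printing Implicit Defensive.
Import GRing.Theory.
Local Open Scope ring_scope.

Inductive polyfun (K : comRingType) (J P : Type) (coord : J -> P -> K)
  : (P -> K) -> Prop :=
| pf_coord (j : J) : polyfun coord (coord j)
| pf_const (a : K) : polyfun coord (fun _ => a)
| pf_add (f g : P -> K) : polyfun coord f -> polyfun coord g ->
    polyfun coord (fun p => f p + g p)
| pf_mul (f g : P -> K) : polyfun coord f -> polyfun coord g ->
    polyfun coord (fun p => f p * g p)
| pf_ext (f g : P -> K) : polyfun coord f -> (forall p, f p = g p) ->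
    polyfun coord g.

Definition zclosure (K : comRingType) (J P : Type) (coord : J -> P -> K)
  (S : P -> Prop) : P -> Prop :=
  fun p => forall f, polyfun coord f -> (forall s, S s -> f s = 0) -> f p = 0.

(* A (Zariski closed) subset X is a normal (affine) variety: its coordinate
   ring K[X] (= polynomial functions restricted to X) is an integrally closed
   integral domain, i.e. X is irreducible (nonempty, K[X] a domain) and every
   element f/g of the fraction field of K[X] which is integral over K[X]
   lies in K[X]. *)
Definition normal_var (K : comRingType) (J P : Type) (coord : J -> P -> K)
  (X : P -> Prop) : Prop :=
  [/\ exists x, X x,
      (forall f g, polyfun coord f -> polyfun coord g ->
         (forall x, X x -> f x * g x = 0) ->
         (forall x, X x -> f x = 0) \/ (forall x, X x -> g x = 0)) &
      (forall f g, polyfun coord f -> polyfun coord g ->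
         (exists x, X x /\ g x != 0) ->
         (exists (d : nat) (a : nat -> P -> K),
             (forall i, polyfun coord (a i)) /\
             (forall x, X x ->
                f x ^+ d.+1 + \sum_(i < d.+1) a i x * f x ^+ i * g x ^+ (d.+1 - i)
                = 0)) ->
         exists h, polyfun coord h /\ (forall x, X x -> f x = h x * g x))].

Definition is_partition (p : seq nat) : bool :=
  sorted geq p && all (fun x => 0 < x)%N p.

Definition is_bipartition (n : nat) (mu nu : seq nat) : Prop :=
  [/\ is_partition mu, is_partition nu & (sumn mu + sumn nu)%N = n].

Definition part (p : seq nat) (i : nat) : nat := nth 0%N p i.

Definition lamseq (mu nu : seq nat) : seq nat :=
  [seq (part mu i + part nu i)%N | i <- iota 0 (maxn (size mu) (size nu))].

Definition conjseq (p : seq nat) : seq nat :=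
  [seq count (fun x => j <= x)%N p | j <- iota 1 (head 0%N p)].

Definition tlen (mu nu : seq nat) : nat := head 0%N (lamseq mu nu).

(* r_i = lambda^t_{t-i}, 0 <= i <= t-1 (column lengths in increasing order) *)
Definition rcol (mu nu : seq nat) (i : nat) : nat :=
  nth 0%N (conjseq (lamseq mu nu)) (tlen mu nu - i.+1).

Definition dimU (mu nu : seq nat) (i : nat) : nat :=
  (\sum_(j < i) rcol mu nu j)%N.

Definition enhI_spec (mu nu : seq nat) (I : pred nat) : Prop :=
  [seq rcol mu nu i | i <- iota 0 (tlen mu nu) & I i] = rev (conjseq mu) /\
  (forall i, (i.+1 < tlen mu nu)%N -> rcol mu nu i = rcol mu nu i.+1 ->
     I i.+1 -> I i).

Definition VEnd (K : Type) (n : nat) : Type := ('cV[K]_n * 'M[K]_n)%type.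

Definition VEnd_coord (K : comRingType) (n : nat)
  (j : ('I_n + ('I_n * 'I_n))%type) (p : VEnd K n) : K :=
  match j with
  | inl i => p.1 i ord0
  | inr ij => p.2 ij.1 ij.2
  end.

Definition enh_orbit (K : fieldType) (n : nat) (mu nu : seq nat)
  (p : VEnd K n) : Prop :=
  let lam := lamseq mu nu in
  exists e : nat -> nat -> 'cV[K]_n,
    [/\ basis_of fullv
          [seq e i j | i <- iota 0 (size lam), j <- iota 1 (part lam i)],
        (forall i, (i < size lam)%N -> e i 0%N = 0),
        (forall i j, (i < size lam)%N -> (1 <= j <= part lam i)%N ->
            p.2 *m e i j = e i j.-1) &
        p.1 = \sum_(i < size lam | (0 < part mu i)%N) e i (part mu i)].

(* Components u_i, A_i, B_i are indexed by all i : nat; those with      *)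
(* indices outside the range (i > t for u, i >= t for A, B) are forced  *)
(* to be 0, so the set is identified with the variety of the paper.     *)

Definition LamPt (K : Type) (d : nat -> nat) : Type :=
  ((forall i : nat, 'cV[K]_(d i)) *
   (forall i : nat, 'M[K]_(d i.+1, d i)) *
   (forall i : nat, 'M[K]_(d i, d i.+1)))%type.

Definition LamIdx (d : nat -> nat) : Type :=
  ({i : nat & 'I_(d i)} +
   {i : nat & ('I_(d i.+1) * 'I_(d i))%type} +
   {i : nat & ('I_(d i) * 'I_(d i.+1))%type})%type.

Definition Lam_coord (K : comRingType) (d : nat -> nat)
  (j : LamIdx d) (p : LamPt K d) : K :=
  match j with
  | inl (inl (existT i k)) => p.1.1 i k ord0
  | inl (inr (existT i kl)) => p.1.2 i kl.1 kl.2
  | inr (existT i kl) => p.2 i kl.1 kl.2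
  end.

Definition Lambda (K : comRingType) (mu nu : seq nat) (I : pred nat)
  (p : LamPt K (dimU mu nu)) : Prop :=
  let t := tlen mu nu in
  let u := p.1.1 in let A := p.1.2 in let B := p.2 in
  [/\ (forall i, (t < i)%N -> u i = 0),
      (forall i, (t <= i)%N -> A i = 0 /\ B i = 0),
      (forall i, (i.+1 < t)%N -> B i.+1 *m A i.+1 = A i *m B i),
      (forall i, (i < t)%N -> I i -> B i *m u i.+1 = u i) &
      (forall i, (i < t)%N -> ~~ I i -> A i *m u i = u i.+1)].

(* Main.v *)
(* The map (u, A, B) |-> (u_t, A_(t-1) B_(t-1)) sends the quiver variety onto a
   dense subset of the orbit closure, and it is invariant under the product of
   the GL(U_i), i < t.  An integral fraction f / g on the closure pulls back to
   a regular function h on the (normal) quiver variety, and h is invariant since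
   f / g is; what is needed is that invariants come from V x End(V).

   Eliminating one U_i at a time with the quiver relations, this becomes the
   first fundamental theorem for GL_r acting on vectors C and covectors D, for
   functions which are invariant only on a stable subset.  It is proved with the
   Fischer product <X^a, X^b> = a! [a = b] on polynomials, for which
   multiplication by a variable is adjoint to the corresponding derivative: the
   part F of h orthogonal both to the polynomials vanishing on the subset and to
   the polynomials in the entries of DC is killed by gl_r, and the identity
   sum_(i,j) (DC)_ij Delta_ij = sum_(k,l) E^D_kl E^C_kl forces F = 0.

   That the image lies in the closure is checked on the open set where all A_i
   are injective and all B_i surjective, irreducibility giving the rest: there
   (A, B) is conjugate to a standard point, with nilpotent N and orbit vector w,
   and u_t corresponds to some c = Q w with Q commuting with N.  Then
   c + s w = (Q + s) w, and Q + s is invertible for all but finitely many s. *)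
Require Import Defs.
From mathcomp Require Import all_boot all_order all_algebra.
From mathcomp Require Import reals.
From mathcomp Require Import complex.
From mathcomp Require Import boolp.
From mathcomp.multinomials Require Import ssrcomplements mpoly.
From mathcomp Require Import ring.
Set Implicit Arguments. Unset Strict Implicit. Unset Printing Implicit Defensive.
Import Order.TTheory GRing.Theory Num.Theory.
Local Open Scope ring_scope.

(** * Polynomials and the Fischer product *)

Lemma poly_eq0_horner (C : numFieldType) (p : {poly C}) :
  (forall s, p.[s] = 0) -> p = 0.
Proof.
move=> p0; apply: (@roots_geq_poly_eq0 _ p [seq i%:R | i <- iota 0 (size p)]).
- by apply/allP => x _; apply/rootP.
- by rewrite map_inj_uniq ?iota_uniq // => i j /eqP; rewrite eqr_nat => /eqP.
- by rewrite size_map size_iota.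
Qed.

Lemma poly_eq0_generic (C : numFieldType) (p r : {poly C}) :
  r != 0 -> (forall s, r.[s] != 0 -> p.[s] = 0) -> p = 0.
Proof.
move=> r0 pr; apply/eqP; have : p * r == 0.
  apply/eqP/poly_eq0_horner => s; rewrite hornerM.
  by have [->|/pr ->] := eqVneq r.[s] 0; rewrite ?mulr0 ?mul0r.
by rewrite mulf_eq0 (negPf r0) orbF.
Qed.

(** * Orthogonal projection in possibly infinite dimension *)

Section OrthogonalProjection.
Variables (C : numClosedFieldType) (V : lmodType C) (ip : V -> V -> C).
Hypothesis ip_linear : forall a u v w, ip (a *: u + v) w = a * ip u w + ip v w.
Hypothesis ip_conj : forall u v, ip v u = (ip u v)^*.
Hypothesis ip_def : forall u, ip u u = 0 -> u = 0.
Variables (T : Type) (phi : T -> V -> C).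
Hypothesis phi_linear :
  forall t a u v, phi t (a *: u + v) = a * phi t u + phi t v.

(** Finite dimension of [P] is encoded by finitely many functionals separating its points. Induction
    on [L]: a functional vanishing on [P] is dropped; otherwise [P] is the kernel of the functional
    in [P] plus a line, and a Gram-Schmidt step adds the missing direction. *)
Lemma ortho_proj (L : seq T) (P : V -> Prop) :
  P 0 -> (forall a u v, P u -> P v -> P (a *: u + v)) ->
  (forall u, P u -> (forall i, (i < size L)%N ->
     forall x0, phi (nth x0 L i) u = 0) -> u = 0) ->
  forall h, exists2 p, P p & forall q, P q -> ip q (h - p) = 0.
Proof.
have ip0l w : ip 0 w = 0.
  have := ip_linear 1 0 0 w; rewrite scale1r addr0 mul1r => e.
  by apply: (addrI (ip 0 w)); rewrite -e addr0.
have phi0 t : phi t 0 = 0.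
  have := phi_linear t 1 0 0; rewrite scale1r addr0 mul1r => e.
  by apply: (addrI (phi t 0)); rewrite -e addr0.
have ip_linr u v w : ip w (u + v) = ip w u + ip w v.
  by rewrite ip_conj -{1}[u]scale1r ip_linear mul1r rmorphD /= -!ip_conj.
have ip_scaler a u w : ip w (a *: u) = a^* * ip w u.
  rewrite ip_conj -[_ *: _]addr0 ip_linear rmorphD rmorphM /= -ip_conj.
  by rewrite ip0l rmorph0 addr0.
elim: L P => [|t L IH] P P0 Plin Psep h.
  exists 0 => // q Pq; have -> : q = 0 by apply: Psep.
  exact: ip0l.
have [[e [Pe et]]|nex] := EM (exists e, P e /\ phi t e != 0); last first.
  apply: IH => // u Pu uL; apply: Psep => // -[|i] ltiL x0; last exact: uL.
  by apply/eqP; apply: contra_notT nex => tu; exists u.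
pose P' u := P u /\ phi t u = 0.
have P'0 : P' 0 by [].
have P'lin a u v : P' u -> P' v -> P' (a *: u + v).
  by case=> Pu tu [Pv tv]; split; [exact: Plin | rewrite phi_linear tu tv mulr0 addr0].
have P'sep u : P' u -> (forall i, (i < size L)%N ->
     forall x0, phi (nth x0 L i) u = 0) -> u = 0.
  by case=> Pu tu uL; apply: Psep => // -[|i] ltiL x0 //=; apply: uL.
have [e1 [Pe1 te1] e1P] := IH _ P'0 P'lin P'sep e.
have [h1 [Ph1 th1] h1P] := IH _ P'0 P'lin P'sep h.
(* [e'] is orthogonal to the kernel [P'] and spans a complement of it in [P]. *)
have [e' e'D] : exists e', e' = e - e1 by exists (e - e1).
have e'E : e' = -1 *: e1 + e by rewrite e'D scaleN1r addrC.
rewrite -e'D in e1P.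
have Pe' : P e' by rewrite e'E; apply: Plin.
have te' : phi t e' = phi t e by rewrite e'E phi_linear te1 mulr0 add0r.
have ne' : ip e' e' != 0.
  by apply: contraNneq et => /ip_def e0; rewrite -te' e0 phi0.
have ipe'h1 : ip e' h1 = 0 by rewrite ip_conj (e1P h1) // rmorph0.
(* The conjugate compensates for the conjugate linearity of [ip] in its second argument. *)
pose b := (ip e' h / ip e' e')^*.
exists (b *: e' + h1); first exact: Plin.
move=> q Pq; pose c := phi t q / phi t e.
have P'q : P' (q - c *: e').
  split; first by rewrite addrC -scaleNr; apply: Plin.
  by rewrite addrC -scaleNr phi_linear te' mulNr divfK // addNr.
have {1}-> : q = c *: e' + (q - c *: e') by rewrite addrC subrK.
have hE : h - (b *: e' + h1) = - b *: e' + (h - h1).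
  by rewrite opprD addrCA scaleNr.
rewrite ip_linear hE !(ip_linr (- b *: e')) !ip_scaler (h1P _ P'q).
rewrite (e1P _ P'q) mulr0 addr0.
have -> : ip e' (h - h1) = ip e' h.
  by rewrite ip_linr -[- h1]scaleN1r ip_scaler ipe'h1 mulr0 addr0.
by rewrite rmorphN /= /b conjCK mulNr divfK // addNr !mulr0 addr0.
Qed.

End OrthogonalProjection.

(** * The Fischer inner product *)

Section Fischer.
Variables (C : numClosedFieldType) (n : nat).
Implicit Types p q : {mpoly C[n]}.

Definition mfact (m : 'X_{1..n}) : nat := (\prod_(i < n) (m i)`!)%N.

Definition fischer p q : C :=
  \sum_(m <- msupp p) (mfact m)%:R * p@_m * (q@_m)^*.

(** Summing over all monomials under a degree bound, rather than over the support of [p], gives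
    several products a common index set, so that linearity and conjugate symmetry hold termwise. *)
Lemma fischerwE k p q : (msize p <= k)%N ->
  fischer p q = \sum_(m : 'X_{1..n < k}) (mfact m)%:R * p@_m * (q@_m)^*.
Proof.
pose I : subFinType _ := 'X_{1..n < k}.
move=> le_pk; rewrite /fischer (big_mksub I) /=; first last.
- by move=> x /msize_mdeg_lt/leq_trans/(_ le_pk).
- by rewrite msupp_uniq.
rewrite big_rmcond //= => j /memN_msupp_eq0 ->.
by rewrite mulr0 mul0r.
Qed.

Lemma fischer_linear a p p' q :
  fischer (a *: p + p') q = a * fischer p q + fischer p' q.
Proof.
pose k := maxn (msize (a *: p + p')) (maxn (msize p) (msize p')).
rewrite !(@fischerwE k) ?leq_max ?leqnn ?orbT // big_distrr -big_split /=.
apply: eq_bigr => m _; rewrite mcoeffD mcoeffZ mulrDr mulrDl; congr (_ + _).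
by rewrite mulrCA !mulrA.
Qed.

Lemma fischerC p q : fischer q p = (fischer p q)^*.
Proof.
pose k := maxn (msize p) (msize q).
rewrite !(@fischerwE k) ?leq_max ?leqnn ?orbT // rmorph_sum /=.
by apply: eq_bigr => m _; rewrite !rmorphM /= conjCK rmorph_nat mulrAC.
Qed.

Lemma mfact_gt0 m : (0 < mfact m)%N.
Proof. by apply: prodn_gt0 => i; rewrite fact_gt0. Qed.

Lemma fischer_ge0 p : 0 <= fischer p p.
Proof.
by apply: sumr_ge0 => m _; rewrite -mulrA mulr_ge0 ?ler0n ?mul_conjC_ge0.
Qed.

Lemma fischer_eq0 p : fischer p p = 0 -> p = 0.
Proof.
rewrite (@fischerwE (msize p)) // => /eqP.
rewrite psumr_eq0; last first.
  by move=> m _; rewrite -mulrA mulr_ge0 ?ler0n ?mul_conjC_ge0.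
move=> /allP p0; apply/mpolyP => m; rewrite mcoeff0.
have [lt_m|] := ltnP (mdeg m) (msize p); last by move/msize_mdeg_ge/memN_msupp_eq0.
have := p0 (BMultinom lt_m); rewrite mem_index_enum => /(_ isT) /=.
by rewrite -mulrA mulf_eq0 pnatr_eq0 -leqn0 leqNgt mfact_gt0 mul_conjC_eq0 => /eqP.
Qed.

Lemma fischerX m q : fischer 'X_[m] q = (mfact m)%:R * (q@_m)^*.
Proof. by rewrite /fischer msuppX big_seq1 mcoeffX eqxx mulr1. Qed.

Lemma fischer0l q : fischer 0 q = 0.
Proof. by rewrite /fischer msupp0 big_nil. Qed.

Lemma fischer0r q : fischer q 0 = 0.
Proof. by rewrite fischerC fischer0l rmorph0. Qed.

Lemma fischerDl p p' q : fischer (p + p') q = fischer p q + fischer p' q.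
Proof. by rewrite -[p]scale1r fischer_linear mul1r scale1r. Qed.

Lemma fischerDr p p' q : fischer q (p + p') = fischer q p + fischer q p'.
Proof. by rewrite fischerC fischerDl rmorphD /= -!fischerC. Qed.

Lemma fischerNl p q : fischer (- p) q = - fischer p q.
Proof. by apply/eqP; rewrite -addr_eq0 -fischerDl addNr fischer0l. Qed.

Lemma fischerNr p q : fischer q (- p) = - fischer q p.
Proof. by rewrite fischerC fischerNl rmorphN /= -fischerC. Qed.

Lemma fischer_suml I (r : seq I) (P : pred I) (F : I -> {mpoly C[n]}) q :
  fischer (\sum_(i <- r | P i) F i) q = \sum_(i <- r | P i) fischer (F i) q.
Proof.
by elim/big_ind2: _ => [|x a y b <- <-|//]; rewrite ?fischer0l ?fischerDl.
Qed.

Lemma fischer_sumr I (r : seq I) (P : pred I) (F : I -> {mpoly C[n]}) q :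
  fischer q (\sum_(i <- r | P i) F i) = \sum_(i <- r | P i) fischer q (F i).
Proof.
by elim/big_ind2: _ => [|x a y b <- <-|//]; rewrite ?fischer0r ?fischerDr.
Qed.

Lemma mfactDU m i : mfact (m + U_(i)) = ((m i).+1 * mfact m)%N.
Proof.
rewrite /mfact (bigD1 i) //= [in RHS](bigD1 i) //= mnmDE mnm1E eqxx addn1 factS.
rewrite -mulnA; congr (_ * (_ * _))%N; apply: eq_bigr => j ne_ji.
by rewrite mnmDE mnm1E eq_sym (negPf ne_ji) addn0.
Qed.

(** On monomials this is (m + e_i)! = (m_i + 1) m!, the factor m_i + 1 being the one produced by
    differentiation. *)
Lemma fischer_mulX i p q : fischer ('X_i * p) q = fischer p q^`M(i).
Proof.
elim/mpolyind: p => [|c m p _ _ IH]; first by rewrite mulr0 !fischer0l.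
rewrite mulrDr fischerDl IH -scalerAr fischerDl -[_ *: _]addr0 -[in RHS](addr0 (_ *: _)).
rewrite !fischer_linear !fischer0l !addr0; congr (_ * _ + _).
rewrite mulrC -mpolyXD !fischerX mcoeff_mderiv mfactDU.
by rewrite natrM mulrAC rmorphMn /= !mulr_natl mulr_natr.
Qed.

Lemma fischer_deriv i p q : fischer p^`M(i) q = fischer p ('X_i * q).
Proof. by rewrite fischerC -fischer_mulX -fischerC. Qed.

Lemma msize_deriv i p d : (msize p <= d)%N -> (msize p^`M(i) <= d.-1)%N.
Proof.
move=> le_pd; rewrite msizeE; apply/bigmax_leqP_seq => m m_in _.
move: m_in; rewrite mcoeff_msupp mcoeff_mderiv => nz.
have : (m + U_(i))%MM \in msupp p.
  by rewrite mcoeff_msupp; apply: contraNneq nz => ->; rewrite mul0rn.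
move=> /msize_mdeg_lt; rewrite mdegD mdeg1 addn1 => lt_m.
by have := leq_trans lt_m le_pd; case: d {le_pd}.
Qed.

Lemma msize_mulX i p d : (msize p <= d)%N -> (msize ('X_i * p) <= d.+1)%N.
Proof.
have [->|p0] := eqVneq p 0; first by rewrite mulr0 msize0.
have X0 : 'X_i != 0 :> {mpoly C[n]} by rewrite -msize_poly_eq0 msizeX.
by rewrite (msizeM X0 p0) msizeX mdeg1 !addSn.
Qed.

Lemma msize_mulX_deriv i j p d : (msize p <= d)%N ->
  (msize ('X_i * p^`M(j)) <= d)%N.
Proof.
case: d => [|d] le_pd; last exact/msize_mulX/(msize_deriv j le_pd).
move: le_pd; rewrite leqn0 msize_poly_eq0 => /eqP ->.
by rewrite mderiv0 mulr0 msize0.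
Qed.

Lemma msize_add p q d :
  (msize p <= d)%N -> (msize q <= d)%N -> (msize (p + q) <= d)%N.
Proof. by move=> pd qd; rewrite (leq_trans (msizeD_le _ _)) // geq_max pd. Qed.

Lemma msize_sum_le I (r : seq I) (P : pred I) (F : I -> {mpoly C[n]}) d :
  (forall i, P i -> (msize (F i) <= d)%N) ->
  (msize (\sum_(i <- r | P i) F i) <= d)%N.
Proof.
move=> Fd; elim/big_ind: _ => //; first by rewrite msize0.
by move=> p q; apply: msize_add.
Qed.

End Fischer.

(** * Derivatives at 1 along Laurent curves *)

Section RegularAtOne.
Variable C : numFieldType.

(* [f] is a Laurent polynomial away from [0] whose derivative at [1] is [f']. *)
Definition laurent_deriv (f : C -> C) (f' : C) :=
  exists N (R : {poly C}), (forall s, s != 0 -> R.[s] = s ^+ N * f s) /\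
    R^`().[1] = N%:R * f 1 + f'.

Lemma laurent_deriv_poly (R : {poly C}) (f : C -> C) :
  (forall s, s != 0 -> R.[s] = f s) -> laurent_deriv f R^`().[1].
Proof.
move=> Rf; exists 0%N, R; split; last by rewrite mul0r add0r.
by move=> s s0; rewrite expr0 mul1r Rf.
Qed.

Lemma laurent_derivD f f' g g' : laurent_deriv f f' -> laurent_deriv g g' ->
  laurent_deriv (fun s => f s + g s) (f' + g').
Proof.
move=> [N [R [Rf R']]] [M [S [Sg S']]].
have R1 := Rf _ (oner_neq0 _); have S1 := Sg _ (oner_neq0 _).
rewrite !expr1n !mul1r in R1 S1.
exists (N + M)%N, (R * 'X^M + S * 'X^N); split.
  move=> s s0; rewrite !(hornerD, hornerM, hornerN, hornerZ, hornerXn).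
  by rewrite Rf // Sg // exprD; ring.
rewrite derivD !derivM !derivXn !(hornerD, hornerM, hornerZ, hornerMn, hornerXn).
rewrite !expr1n R' S' R1 S1.
by rewrite natrD; ring.
Qed.

Lemma laurent_derivM f f' g g' : laurent_deriv f f' -> laurent_deriv g g' ->
  laurent_deriv (fun s => f s * g s) (f' * g 1 + f 1 * g').
Proof.
move=> [N [R [Rf R']]] [M [S [Sg S']]].
have R1 := Rf _ (oner_neq0 _); have S1 := Sg _ (oner_neq0 _).
rewrite !expr1n !mul1r in R1 S1.
exists (N + M)%N, (R * S); split.
  by move=> s s0; rewrite hornerM Rf // Sg // exprD; ring.
by rewrite derivM hornerD !hornerM R' S' R1 S1 natrD; ring.
Qed.

Lemma laurent_deriv_const f f' c : laurent_deriv f f' ->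
  (forall s, s != 0 -> f s = c) -> f' = 0.
Proof.
move=> [N [R [Rf R']]] fc.
have RE : R = c *: 'X^N.
  apply/eqP; rewrite -subr_eq0; apply/eqP.
  apply: (@poly_eq0_generic _ _ 'X); first by rewrite polyX_eq0.
  move=> s; rewrite hornerX => s0.
  by rewrite !(hornerD, hornerM, hornerN, hornerZ, hornerXn) Rf // fc // mulrC subrr.
move: R'; rewrite RE derivZ derivXn !(hornerD, hornerM, hornerZ, hornerMn, hornerXn) expr1n.
rewrite fc ?oner_neq0 // mulrC -[LHS]addr0 => /addrI.
by move->.
Qed.

Lemma laurent_deriv_meval n (x : C -> 'I_n -> C) (v : 'I_n -> C) :
  (forall i, laurent_deriv (x^~ i) (v i)) -> forall p : {mpoly C[n]},
  laurent_deriv (fun s => p.@[x s]) (\sum_i v i * p^`M(i).@[x 1]).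
Proof.
move=> xv p.
pose Q p := laurent_deriv (fun s => p.@[x s]) (\sum_i v i * p^`M(i).@[x 1]).
have Qext (f g : C -> C) f' g' : (forall s, f s = g s) -> f' = g' ->
    laurent_deriv f f' -> laurent_deriv g g'.
  move=> fg <- [N [R [Rf R']]]; exists N, R.
  by split; [move=> s s0; rewrite -fg Rf | rewrite -fg].
have QC c : Q c%:MP.
  apply: (Qext _ _ _ _ _ _ (@laurent_deriv_poly c%:P (fun _ => c) _)).
  - by move=> s; rewrite mevalC.
  - rewrite derivC horner0 big1 // => i _.
    by rewrite mderivC meval0 mulr0.
  - by move=> s _; rewrite hornerC.
have QX i : Q 'X_i.
  apply: Qext (xv i); first by move=> s; rewrite mevalXU.
  rewrite (bigD1 i) //= mderivX mnm1E eqxx scale1r.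
  rewrite (_ : (U_(i) - U_(i))%MM = 0%MM); last first.
    by apply/mnmP => j; rewrite mnmBE subnn mnm0E.
  rewrite mpolyX0 meval1 mulr1 big1 ?addr0 // => j ne_ji.
  by rewrite mderivX mnm1E eq_sym (negPf ne_ji) scale0r meval0 mulr0.
have QM p1 p2 : Q p1 -> Q p2 -> Q (p1 * p2).
  move=> Q1 Q2; apply: Qext (laurent_derivM Q1 Q2).
    by move=> s; rewrite mevalM.
  rewrite mulr_suml mulr_sumr -big_split /=; apply: eq_bigr => i _.
  by rewrite mderivM mevalD !mevalM; ring.
have QD p1 p2 : Q p1 -> Q p2 -> Q (p1 + p2).
  move=> Q1 Q2; apply: Qext (laurent_derivD Q1 Q2).
    by move=> s; rewrite mevalD.
  rewrite -big_split /=; apply: eq_bigr => i _.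
  by rewrite mderivD mevalD mulrDr.
elim/mpolyind: p => [|c m p _ _]; first by rewrite -mpolyC0; apply: QC.
apply: (QD); rewrite -mul_mpolyC; apply: (QM); first exact: QC.
rewrite mpolyXE_id; apply: (big_ind Q) => [|p1 p2|i _]; first exact: (QC 1).
  exact: QM.
by elim: (m i) => [|k IH]; [exact: (QC 1) | rewrite exprS; exact: QM].
Qed.

End RegularAtOne.

(** * Invariants of vectors and covectors *)

Lemma polyfun_sum (K : comNzRingType) (J P : Type) (coord : J -> P -> K)
    I (r : seq I) (Q : pred I) (F : I -> P -> K) :
  (forall i, Q i -> polyfun coord (F i)) ->
  polyfun coord (fun p => \sum_(i <- r | Q i) F i p).
Proof.
move=> FP; elim: r => [|i r IH].
  by apply: pf_ext (pf_const coord 0) _ => p; rewrite big_nil.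
have [Qi|nQi] := boolP (Q i).
  by apply: pf_ext (pf_add (FP i Qi) IH) _ => p; rewrite big_cons Qi.
by apply: pf_ext IH _ => p; rewrite big_cons (negPf nQi).
Qed.

Lemma polyfun_prod (K : comNzRingType) (J P : Type) (coord : J -> P -> K)
    I (r : seq I) (Q : pred I) (F : I -> P -> K) :
  (forall i, Q i -> polyfun coord (F i)) ->
  polyfun coord (fun p => \prod_(i <- r | Q i) F i p).
Proof.
move=> FP; elim: r => [|i r IH].
  by apply: pf_ext (pf_const coord 1) _ => p; rewrite big_nil.
have [Qi|nQi] := boolP (Q i).
  by apply: pf_ext (pf_mul (FP i Qi) IH) _ => p; rewrite big_cons Qi.
by apply: pf_ext IH _ => p; rewrite big_cons (negPf nQi).
Qed.

Lemma polyfun_exp (K : comNzRingType) (J P : Type) (coord : J -> P -> K) f k :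
  polyfun coord f -> polyfun coord (fun p => f p ^+ k).
Proof.
move=> fP; elim: k => [|k IH].
  by apply: pf_ext (pf_const coord 1) _ => p; rewrite expr0.
by apply: pf_ext (pf_mul fP IH) _ => p; rewrite exprS.
Qed.

(** * First fundamental theorem for GL_r on a stable subset *)

Section FirstFundamentalTheorem.
Variables (C : numClosedFieldType) (r p q N : nat).

(** The entries of an r by p matrix C and of a q by r matrix D, and N parameters on which GL_r acts
    trivially; the parameters will carry the coordinates of the other vertices. *)
Definition ffvar : finType := ('I_r * 'I_p + 'I_q * 'I_r + 'I_N)%type.
Let n := #|ffvar|.
Definition fvC k j : 'I_n := enum_rank (inl (inl (k, j)) : ffvar).
Definition fvD i k : 'I_n := enum_rank (inl (inr (i, k)) : ffvar).
Definition fvY l : 'I_n := enum_rank (inr l : ffvar).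

Definition ffact (g : 'M[C]_r) (x : 'I_n -> C) : 'I_n -> C :=
  fun v => match enum_val v with
    | inl (inl (k, j)) => \sum_l g k l * x (fvC l j)
    | inl (inr (i, k)) => \sum_l x (fvD i l) * invmx g l k
    | inr _ => x v
    end.

Lemma ffactC g x k j : ffact g x (fvC k j) = \sum_l g k l * x (fvC l j).
Proof. by rewrite /ffact enum_rankK. Qed.

Lemma ffactD g x i k : ffact g x (fvD i k) = \sum_l x (fvD i l) * invmx g l k.
Proof. by rewrite /ffact enum_rankK. Qed.

Lemma ffactY g x l : ffact g x (fvY l) = x (fvY l).
Proof. by rewrite /ffact enum_rankK. Qed.

Lemma ffvarP (T : 'I_n -> Prop) : (forall k j, T (fvC k j)) ->
  (forall i k, T (fvD i k)) -> (forall l, T (fvY l)) -> forall v, T v.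
Proof.
move=> TC TD TY v; rewrite -(enum_valK v).
by case: (enum_val v) => [[[k j]|[i k]]|l]; [exact: TC | exact: TD | exact: TY].
Qed.

Definition ffgen (j : ('I_q * 'I_p + 'I_N)%type) (x : 'I_n -> C) : C :=
  match j with
  | inl (i, j) => \sum_k x (fvD i k) * x (fvC k j)
  | inr l => x (fvY l)
  end.

Implicit Types (F G : {mpoly C[n]}) (x : 'I_n -> C).

Definition ffim F := polyfun ffgen (fun x => F.@[x]).

(** Polarization operator: the derivation sending row l of C to row k. [ED] does the same with the
    columns of D. *)
Definition EC k l F : {mpoly C[n]} := \sum_j 'X_(fvC k j) * F^`M(fvC l j).
Definition ED k l F : {mpoly C[n]} := \sum_i 'X_(fvD i k) * F^`M(fvD i l).
(** The infinitesimal action of gl_r; the sign and the swapped indices reflect the action on D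
    through the inverse. *)
Definition EL k l F := EC k l F - ED l k F.
(** The Fischer adjoint of multiplication by the entry (i, j) of DC. *)
Definition Delta i j F : {mpoly C[n]} := \sum_k F^`M(fvC k j)^`M(fvD i k).
Definition zgen i j : {mpoly C[n]} := \sum_k 'X_(fvD i k) * 'X_(fvC k j).

Lemma fischer_mulX_deriv u v F G :
  fischer ('X_u * F^`M(v)) G = fischer F ('X_v * G^`M(u)) :> C.
Proof. by rewrite fischer_mulX fischer_deriv. Qed.

Lemma fischer_EC k l F G : fischer (EC k l F) G = fischer F (EC l k G).
Proof.
rewrite fischer_suml fischer_sumr; apply: eq_bigr => j _.
exact: fischer_mulX_deriv.
Qed.

Lemma fischer_ED k l F G : fischer (ED k l F) G = fischer F (ED l k G).
Proof.
rewrite fischer_suml fischer_sumr; apply: eq_bigr => j _.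
exact: fischer_mulX_deriv.
Qed.

Lemma fischer_EL k l F G : fischer (EL k l F) G = fischer F (EL l k G).
Proof.
by rewrite fischerDl fischerDr fischerNl fischerNr fischer_EC fischer_ED.
Qed.

Lemma fischer_zgen i j F G : fischer (zgen i j * F) G = fischer F (Delta i j G).
Proof.
rewrite mulr_suml fischer_suml fischer_sumr; apply: eq_bigr => k _.
by rewrite -mulrA !fischer_mulX mderiv_comm.
Qed.

Lemma deriv_X u v : ('X_u : {mpoly C[n]})^`M(v) = (u == v)%:R.
Proof.
rewrite mderivX mnm1E; have [->|_] := eqVneq u v; last by rewrite scale0r.
rewrite scale1r (_ : (U_(v) - U_(v))%MM = 0%MM) ?mpolyX0 //.
by apply/mnmP => j; rewrite mnmBE subnn mnm0E.
Qed.

Lemma fvCE k j k' j' : (fvC k j == fvC k' j') = (k == k') && (j == j').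
Proof. by rewrite (inj_eq enum_rank_inj). Qed.
Lemma fvDE i k i' k' : (fvD i k == fvD i' k') = (i == i') && (k == k').
Proof. by rewrite (inj_eq enum_rank_inj). Qed.
Lemma fvCD k j i l : (fvC k j == fvD i l) = false.
Proof. by rewrite (inj_eq enum_rank_inj). Qed.
Lemma fvDC k j i l : (fvD i l == fvC k j) = false.
Proof. by rewrite (inj_eq enum_rank_inj). Qed.

(** Commuting the derivatives past [EC] and past [ED] leaves one Kronecker delta term each; after
    summation over the contracted index the two are equal and cancel. *)
Lemma Delta_EL i j k l F : Delta i j (EL k l F) = EL k l (Delta i j F).
Proof.
have derivC a : (EC k l F)^`M(fvC a j) =
    EC k l F^`M(fvC a j) + (k == a)%:R * F^`M(fvC l j).
  rewrite /EC raddf_sum /= mulr_natl.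
  rewrite (eq_bigr (fun b => 'X_(fvC k b) * F^`M(fvC a j)^`M(fvC l b) +
      ((k == a) && (b == j))%:R * F^`M(fvC l b))); last first.
    by move=> b _; rewrite mderivM deriv_X fvCE addrC mderiv_comm.
  rewrite big_split; congr (_ + _); rewrite (bigD1 j) //= eqxx andbT big1.
    by rewrite addr0 mulr_natl.
  by move=> b /negPf ->; rewrite andbF mul0r.
have derivD G a : (EC k l G)^`M(fvD i a) = EC k l G^`M(fvD i a).
  rewrite /EC raddf_sum; apply: eq_bigr => b _ /=.
  by rewrite mderivM deriv_X fvCD mul0r add0r mderiv_comm.
have derivD' G a : (ED l k G)^`M(fvD i a) =
    ED l k G^`M(fvD i a) + (l == a)%:R * G^`M(fvD i k).
  rewrite /ED raddf_sum /= mulr_natl.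
  rewrite (eq_bigr (fun b => 'X_(fvD b l) * G^`M(fvD i a)^`M(fvD b k) +
      ((b == i) && (l == a))%:R * G^`M(fvD b k))); last first.
    by move=> b _; rewrite mderivM deriv_X fvDE addrC mderiv_comm.
  rewrite big_split; congr (_ + _); rewrite (bigD1 i) //= eqxx /= big1.
    by rewrite addr0 mulr_natl.
  by move=> b /negPf ->; rewrite mul0r.
have derivC' a : (ED l k F)^`M(fvC a j) = ED l k F^`M(fvC a j).
  rewrite /ED raddf_sum; apply: eq_bigr => b _ /=.
  by rewrite mderivM deriv_X fvDC mul0r add0r mderiv_comm.
have ECsum (H : 'I_r -> {mpoly C[n]}) : EC k l (\sum_a H a) = \sum_a EC k l (H a).
  rewrite /EC exchange_big; apply: eq_bigr => b _.
  by rewrite raddf_sum mulr_sumr.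
have EDsum (H : 'I_r -> {mpoly C[n]}) : ED l k (\sum_a H a) = \sum_a ED l k (H a).
  rewrite /ED exchange_big; apply: eq_bigr => b _.
  by rewrite raddf_sum mulr_sumr.
rewrite /EL /Delta ECsum EDsum -sumrB.
transitivity (\sum_a (EC k l F^`M(fvC a j)^`M(fvD i a)
   - ED l k F^`M(fvC a j)^`M(fvD i a)
   + ((k == a)%:R * F^`M(fvC l j)^`M(fvD i a)
      - (l == a)%:R * F^`M(fvC a j)^`M(fvD i k)))).
  apply: eq_bigr => a _; rewrite raddfB raddfB /= derivC derivC' derivD'.
  rewrite raddfD /= derivD [X in _ + X - _]mderivM.
  have -> : ((k == a)%:R : {mpoly C[n]})^`M(fvD i a) = 0.
    by rewrite -mpolyC_nat mderivC.
  by rewrite mul0r add0r; ring.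
rewrite big_split /= [X in _ + X]sumrB.
have delta b (H : 'I_r -> {mpoly C[n]}) : \sum_a (b == a)%:R * H a = H b.
  rewrite (bigD1 b) //= eqxx mul1r big1 ?addr0 // => a.
  by rewrite eq_sym => /negPf ->; rewrite mul0r.
rewrite (delta k (fun a => F^`M(fvC l j)^`M(fvD i a))).
rewrite (delta l (fun a => F^`M(fvC a j)^`M(fvD i k))).
by rewrite subrr addr0.
Qed.

(** Both sides expand to the same sum with all variables to the left of all derivatives; no lower
    order term arises because the derivatives in D do not see the variables in C. *)
Lemma sum_zgen_Delta F :
  \sum_i \sum_j zgen i j * Delta i j F = \sum_k \sum_l ED k l (EC k l F).
Proof.
have zD i j : zgen i j * Delta i j F = \sum_k \sum_l
    'X_(fvD i k) * ('X_(fvC k j) * F^`M(fvC l j)^`M(fvD i l)).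
  rewrite mulr_suml; apply: eq_bigr => k _; rewrite mulr_sumr.
  by apply: eq_bigr => l _; rewrite mulrA.
have EE k l : ED k l (EC k l F) = \sum_i \sum_j
    'X_(fvD i k) * ('X_(fvC k j) * F^`M(fvC l j)^`M(fvD i l)).
  apply: eq_bigr => i _; rewrite /EC raddf_sum mulr_sumr /=.
  by apply: eq_bigr => j _; rewrite mderivM deriv_X fvCD mul0r add0r.
under eq_bigr do under eq_bigr do rewrite zD.
under [RHS]eq_bigr do under eq_bigr do rewrite EE.
under eq_bigr do rewrite exchange_big /=.
rewrite exchange_big /=; apply: eq_bigr => k _.
under eq_bigr do rewrite exchange_big /=.
by rewrite exchange_big.
Qed.

Lemma ffim_mul F G : ffim F -> ffim G -> ffim (F * G).
Proof. by move=> iF iG; apply: pf_ext (pf_mul iF iG) _ => x; rewrite mevalM. Qed.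

Lemma ffim_zgen i j : ffim (zgen i j).
Proof.
apply: pf_ext (pf_coord _ (inl (i, j))) _ => x /=.
by rewrite raddf_sum; apply: eq_bigr => k _; rewrite /= mevalM !mevalXU.
Qed.

Lemma mderiv_eq0_msupp v F m : F^`M(v) = 0 -> m \in msupp F -> m v = 0%N.
Proof.
move=> dF mF; apply/eqP; apply: contraLR mF; rewrite -lt0n => m0.
have : F^`M(v)@_(m - U_(v)) = 0 by rewrite dF mcoeff0.
rewrite mcoeff_mderiv submK; last first.
  by apply/mnm_lepP => l; rewrite mnm1E; case: eqP => // <-.
by move/eqP; rewrite mulrn_eq0 /= mcoeff_eq0.
Qed.

Lemma ffim_const_CD F : (forall k j, F^`M(fvC k j) = 0) ->
  (forall i k, F^`M(fvD i k) = 0) -> ffim F.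
Proof.
move=> dC dD.
pose f x := \sum_(m <- msupp F | m \in msupp F) F@_m * \prod_i x i ^+ m i.
suff fP : polyfun ffgen f.
  by apply: pf_ext fP _ => x; rewrite mevalE [RHS]big_seq.
apply: polyfun_sum => m mF; apply: pf_mul (pf_const _ _) _.
apply: polyfun_prod => v _; elim/ffvarP: v => [k j|i k|l].
- by apply: pf_ext (pf_const _ 1) _ => x; rewrite (mderiv_eq0_msupp (dC _ _) mF).
- by apply: pf_ext (pf_const _ 1) _ => x; rewrite (mderiv_eq0_msupp (dD _ _) mF).
- exact: polyfun_exp (pf_coord _ (inr l)).
Qed.

(* The Casimir identity [sum_zgen_Delta] turns [Delta F = 0] into
   [sum |ED l k F|^2 = 0]. *)
Lemma invariant_ortho_ffim d F : (msize F <= d)%N ->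
  (forall k l, EL k l F = 0) ->
  (forall G, ffim G -> (msize G <= d)%N -> fischer G F = 0) -> F = 0.
Proof.
elim/ltn_ind: d F => -[|d] IH F Fd LF Fo.
  by apply/eqP; rewrite -msize_poly_eq0 -leqn0.
(* [Delta i j F] has lower degree, is again killed by [EL], and is orthogonal to [ffim] by
   adjunction, so the induction hypothesis applies. *)
have D0 i j : Delta i j F = 0.
  apply: (IH (d.-1)); first by rewrite ltnS leq_pred.
  - apply: msize_sum_le => k _.
    exact: (msize_deriv _ (msize_deriv _ Fd)).
  - move=> k l; rewrite -Delta_EL LF /Delta.
    by rewrite big1 // => a _; rewrite !mderiv0.
  - move=> G iG Gd; rewrite -fischer_zgen; apply: Fo.
      by apply: ffim_mul => //; apply: ffim_zgen.
    have [->|G0] := eqVneq G 0; first by rewrite mulr0 msize0.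
    (* Multiplication by [zgen] raises the bound by two, from [d.-1] to [d.+1]; the predecessor must
       not truncate. *)
    have d0 : (0 < d)%N.
      move: G0; rewrite -msize_poly_eq0 -lt0n => G0.
      by have := leq_trans G0 Gd; case: (d).
    rewrite mulr_suml; apply: msize_sum_le => k _; rewrite -mulrA.
    by rewrite -[d]prednK //; exact: msize_mulX (msize_mulX _ Gd).
have LE k l : EC k l F = ED l k F by apply/eqP; rewrite -subr_eq0 -/(EL k l F) LF.
have S0 : \sum_k \sum_l fischer (ED l k F) (ED l k F) = 0.
  transitivity (fischer (\sum_i \sum_j zgen i j * Delta i j F) F).
    rewrite sum_zgen_Delta fischer_suml; apply: eq_bigr => k _.
    by rewrite fischer_suml; apply: eq_bigr => l _; rewrite LE [RHS]fischer_ED.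
  rewrite big1 ?fischer0l // => i _; rewrite big1 // => j _.
  by rewrite D0 mulr0.
have E0 k l : ED l k F = 0.
  apply: fischer_eq0; apply/eqP.
  have := S0 => /eqP; rewrite psumr_eq0; last first.
    by move=> a _; apply: sumr_ge0 => b _; apply: fischer_ge0.
  move=> /allP/(_ k); rewrite mem_index_enum => /(_ isT) /=.
  rewrite psumr_eq0; last by move=> b _; apply: fischer_ge0.
  by move=> /allP/(_ l); rewrite mem_index_enum => /(_ isT).
(* The diagonal operators are Euler operators: the product of [EC k k F] with [F] is the sum of the
   squared norms of the derivatives of [F] in row k of C, and similarly for D. So [F] involves
   neither C nor D, lies in [ffim], and is orthogonal to itself. *)
apply: fischer_eq0; apply: Fo => //; apply: ffim_const_CD => [k j|i k].
- apply: fischer_eq0; apply/eqP.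
  have /eqP : fischer (EC k k F) F = 0 by rewrite LE E0 fischer0l.
  rewrite fischer_suml.
  rewrite (eq_bigr (fun j => fischer F^`M(fvC k j) F^`M(fvC k j))); last first.
    by move=> b _; rewrite fischer_mulX.
  rewrite psumr_eq0; last by move=> b _; apply: fischer_ge0.
  by move=> /allP/(_ j); rewrite mem_index_enum => /(_ isT).
- apply: fischer_eq0; apply/eqP.
  have /eqP : fischer (ED k k F) F = 0 by rewrite E0 fischer0l.
  rewrite fischer_suml.
  rewrite (eq_bigr (fun i => fischer F^`M(fvD i k) F^`M(fvD i k))); last first.
    by move=> b _; rewrite fischer_mulX.
  rewrite psumr_eq0; last by move=> b _; apply: fischer_ge0.
  by move=> /allP/(_ i); rewrite mem_index_enum => /(_ isT).
Qed.

Lemma delta_mx_sqr k l : k != l -> delta_mx k l *m delta_mx k l = 0 :> 'M[C]_r.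
Proof. by move=> kl; rewrite mul_delta_mx_0 // eq_sym. Qed.

(* The derivative at s = 1 of F along the curve 1 + (s - 1) E_kl in GL_r. *)
Lemma EL_eq0_of_invariant F x :
  (forall g, g \in unitmx -> F.@[ffact g x] = F.@[x]) ->
  forall k l, (EL l k F).@[x] = 0.
Proof.
move=> Finv k l.
pose g (s : C) : 'M[C]_r := 1%:M + (s - 1) *: delta_mx k l.
pose g' (s : C) : 'M[C]_r := if k == l then 1%:M + (s^-1 - 1) *: delta_mx k l
  else 1%:M - (s - 1) *: delta_mx k l.
have gg' (s : C) : s != 0 -> g s *m g' s = 1%:M.
  move=> s0; rewrite /g /g'; have [->|kl] := eqVneq k l.
    rewrite mulmxDl mul1mx mulmxDr mulmx1 -scalemxAl -scalemxAr mul_delta_mx.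
    have e : (s^-1 - 1) + ((s - 1) + (s - 1) * (s^-1 - 1)) = 0 by field.
    by rewrite -addrA scalerA -!scalerDl e scale0r addr0.
  rewrite mulmxDl mul1mx mulmxBr mulmx1 -scalemxAl -scalemxAr delta_mx_sqr //.
  by rewrite !scaler0 subr0 subrK.
have gU (s : C) : s != 0 -> g s \in unitmx by move=> /gg' /mulmx1_unit [].
have gV (s : C) : s != 0 -> invmx (g s) = g' s.
  by move=> s0; rewrite -[LHS]mulmx1 -(gg' s s0) mulKmx // gU.
have g1 : g 1 = 1%:M by rewrite /g subrr scale0r addr0.
have act1 : ffact 1%:M x =1 x.
  elim/ffvarP => [a j|i a|j]; rewrite ?ffactC ?ffactD ?ffactY //.
    rewrite (bigD1 a) //= mxE eqxx mul1r big1 ?addr0 // => b ne.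
    by rewrite mxE eq_sym (negPf ne) mul0r.
  rewrite invmx1 (bigD1 a) //= mxE eqxx mulr1 big1 ?addr0 // => b ne.
  by rewrite mxE (negPf ne) mulr0.
(* The velocity at s = 1 of the curve [ffact (g s) x]. *)
pose v (i : 'I_n) : C := match enum_val i : ffvar with
  | inl (inl (a, j)) => (a == k)%:R * x (fvC l j)
  | inl (inr (i, a)) => - ((a == l)%:R * x (fvD i k))
  | inr _ => 0
  end.
have deriv_act i : laurent_deriv (fun s => ffact (g s) x i) (v i).
  elim/ffvarP: i => [a j|i a|j].
  - have -> : v (fvC a j) =
        ((x (fvC a j))%:P + ('X - 1%:P) * ((a == k)%:R * x (fvC l j))%:P)^`().[1].
      rewrite /v enum_rankK derivD derivM derivB derivX !derivC.
      by rewrite !(hornerD, hornerM, hornerN, hornerC, hornerX); ring.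
    apply: laurent_deriv_poly => /= s _.
    rewrite ffactC !(hornerD, hornerM, hornerN, hornerC, hornerX).
    rewrite (eq_bigr (fun b => (a == b)%:R * x (fvC b j)
       + (b == l)%:R * ((s - 1) * ((a == k)%:R * x (fvC b j))))); last first.
      move=> b _; rewrite !mxE mulrDl; congr (_ + _).
      by case: (a == k); case: (b == l); rewrite /= ?(mulr0, mul0r, mul1r, mulr1).
    rewrite big_split /= (bigD1 a) //= eqxx mul1r big1 ?addr0; last first.
      by move=> b; rewrite eq_sym => /negPf ->; rewrite mul0r.
    rewrite (bigD1 l) //= eqxx mul1r big1 ?addr0 //.
    by move=> b /negPf ->; rewrite mul0r.
  - have actE (s : C) : s != 0 -> ffact (g s) x (fvD i a) = x (fvD i a) +
        (a == l)%:R * ((if k == l then s^-1 - 1 else 1 - s) * x (fvD i k)).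
      move=> s0; rewrite ffactD gV //.
      rewrite (eq_bigr (fun b => (b == a)%:R * x (fvD i b) + (b == k)%:R *
        ((a == l)%:R * ((if k == l then s^-1 - 1 else 1 - s) * x (fvD i b))))).
        rewrite big_split /= (bigD1 a) //= eqxx mul1r big1 ?addr0; last first.
          by move=> b /negPf ->; rewrite mul0r.
        rewrite (bigD1 k) //= eqxx mul1r big1 ?addr0 //.
        by move=> b /negPf ->; rewrite mul0r.
      move=> b _; rewrite /g'; case: (k == l); rewrite !mxE;
      by case: (b == k); case: (a == l);
        rewrite /= ?(mulr0, mul0r, mul1r, mulr1, addr0, subr0, oppr0, mulrDr); ring.
    have -> : v (fvD i a) = - ((a == l)%:R * x (fvD i k)) by rewrite /v enum_rankK.
    move: actE; case: (k == l) => actE; last first.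
      have -> : - ((a == l)%:R * x (fvD i k)) =
         ((x (fvD i a))%:P + ((a == l)%:R * x (fvD i k))%:P * (1%:P - 'X))^`().[1].
        rewrite derivD derivM derivB derivX !derivC.
        by rewrite !(hornerD, hornerM, hornerN, hornerC, hornerX); ring.
      apply: laurent_deriv_poly =>  s s0; rewrite actE //.
      by rewrite !(hornerD, hornerM, hornerN, hornerC, hornerX); ring.
    exists 1%N, ((x (fvD i a))%:P * 'X + ((a == l)%:R * x (fvD i k))%:P * (1%:P - 'X)).
    split=> [s s0|].
      rewrite actE // !(hornerD, hornerM, hornerN, hornerC, hornerX).
      by field.
    rewrite actE ?oner_neq0 // derivD !derivM derivB derivX !derivC.
    by rewrite !(hornerD, hornerM, hornerN, hornerC, hornerX) invr1; ring.
  - have -> : v (fvY j) = ((x (fvY j))%:P)^`().[1].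
      by rewrite /v enum_rankK derivC hornerC.
    by apply: laurent_deriv_poly => /= s _; rewrite hornerC ffactY.
have := laurent_deriv_const (laurent_deriv_meval deriv_act F)
  (fun s s0 => Finv _ (gU s s0)).
under eq_bigr do rewrite g1 (meval_eq _ act1).
move=> <-.
rewrite (reindex (@enum_rank ffvar)) /=; last first.
  by exists enum_val => i _; rewrite ?enum_rankK ?enum_valK.
rewrite big_sumType big_sumType /= /EL /EC /ED.
rewrite [X in _ = _ + X]big1 ?addr0; last by move=> i _; rewrite /v enum_rankK mul0r.
have meval_sum m (H : 'I_m -> {mpoly C[n]}) : (\sum_i H i).@[x] = \sum_i (H i).@[x].
  exact: raddf_sum.
rewrite mevalB !meval_sum -sumrN; congr (_ + _).
- transitivity (\sum_a \sum_j v (fvC a j) * (F^`M(fvC a j)).@[x]);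
    last by rewrite pair_bigA; apply: eq_bigr => -[].
  rewrite (bigD1 k) //= [X in _ = _ + X]big1 ?addr0.
    by apply: eq_bigr => j _; rewrite mevalM mevalXU /v enum_rankK eqxx mul1r.
  move=> a /negPf ak; rewrite big1 // => j _.
  by rewrite /v enum_rankK ak !mul0r.
- transitivity (\sum_i \sum_a v (fvD i a) * (F^`M(fvD i a)).@[x]);
    last by rewrite pair_bigA; apply: eq_bigr => -[].
  apply: eq_bigr => i _; rewrite (bigD1 l) //= [X in _ = _ + X]big1 ?addr0.
    by rewrite mevalM mevalXU /v enum_rankK eqxx mul1r mulNr.
  by move=> a /negPf al; rewrite /v enum_rankK al mul0r oppr0 mul0r.
Qed.

Lemma ffgen_invariant f g x : polyfun ffgen f -> g \in unitmx ->
  f (ffact g x) = f x.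
Proof.
move=> fP gU; elim: fP => {f} [[[i j]|l]|c|f f' _ -> _ ->|f f' _ -> _ ->|f f' _ IH fE] //=.
- transitivity (\sum_l \sum_m x (fvD i l) * x (fvC m j) * (invmx g *m g) l m).
    under eq_bigr do rewrite ffactC ffactD big_distrl /=.
    rewrite exchange_big; apply: eq_bigr => l _ /=.
    under eq_bigr do rewrite big_distrr /=.
    rewrite exchange_big; apply: eq_bigr => m _ /=.
    by rewrite mxE big_distrr; apply: eq_bigr => k _; rewrite /=; ring.
  rewrite mulVmx //; apply: eq_bigr => l _.
  rewrite (bigD1 l) //= mxE eqxx mulr1 big1 ?addr0 // => m ne.
  by rewrite mxE eq_sym (negPf ne) mulr0.
- by rewrite ffactY.
- by rewrite -!fE.
Qed.

(* With [P] the polynomials of bounded degree of the form (vanishing on [Z]) +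
   (polynomial in the contractions), the component of [h] orthogonal to [P] is
   killed by all of [EL], hence is zero. *)
Lemma invariant_on_ffim (Z : ('I_n -> C) -> Prop) (h : {mpoly C[n]}) :
  (forall x g, Z x -> g \in unitmx -> Z (ffact g x)) ->
  (forall x g, Z x -> g \in unitmx -> h.@[ffact g x] = h.@[x]) ->
  exists2 f, ffim f & forall x, Z x -> h.@[x] = f.@[x].
Proof.
move=> Zact hinv; pose d := msize h.
pose P F := (msize F <= d)%N /\ exists m f,
  [/\ F = m + f, forall x, Z x -> m.@[x] = 0 & ffim f].
have ffim0 : ffim 0.
  by apply: pf_ext (pf_const _ 0) _ => x; rewrite meval0.
have PZ F : (msize F <= d)%N -> (forall x, Z x -> F.@[x] = 0) -> P F.
  by move=> Fd FZ; split=> //; exists F, 0; split; rewrite ?addr0.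
have Pim F : (msize F <= d)%N -> ffim F -> P F.
  move=> Fd iF; split=> //; exists 0, F.
  by split=> //; rewrite ?add0r // => x _; rewrite meval0.
have P0 : P 0 by apply: Pim; rewrite ?msize0.
have Plin a F G : P F -> P G -> P (a *: F + G).
  move=> [Fd [m [f [FE mZ fP]]]] [Gd [m' [f' [GE mZ' fP']]]].
  split; first by apply: msize_add => //; apply: leq_trans (msizeZ_le _ _) Fd.
  exists (a *: m + m'), (a *: f + f'); split.
  - by rewrite FE GE scalerDr addrACA.
  - by move=> x Zx; rewrite mevalD mevalZ mZ // mZ' // mulr0 addr0.
  - apply: pf_ext (pf_add (pf_mul (pf_const _ a) fP) fP') _ => x.
    by rewrite mevalD mevalZ.
(* The coefficients of degree below [d] are the finitely many functionals separating [P]. *)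
have Psep F : P F -> (forall i, (i < size [seq val m | m : 'X_{1..n < d}])%N ->
    forall x0 : 'X_{1..n}, F@_(nth x0 [seq val m | m : 'X_{1..n < d}] i) = 0) -> F = 0.
  move=> [Fd _] F0; apply/mpolyP => m; rewrite mcoeff0.
  have [lt_m|] := ltnP (mdeg m) d; last first.
    by move/(leq_trans Fd)/msize_mdeg_ge/memN_msupp_eq0.
  have mL : m \in [seq val m | m : 'X_{1..n < d}].
    by apply/mapP; exists (BMultinom lt_m); rewrite ?mem_enum.
  by rewrite -(nth_index m mL); apply: F0; rewrite index_mem.
have [f0 [f0d [m [f [f0E mZ fP]]]] ho] := ortho_proj (@fischer_linear C n)
  (@fischerC C n) (@fischer_eq0 C n)
  (fun m a u v => etrans (mcoeffD m _ _) (congr1 (+%R^~ _) (mcoeffZ _ _ _)))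
  P0 Plin Psep h.
exists f => // x Zx; apply/eqP; rewrite -subr_eq0 -[_ - _]subr0 -(mZ x Zx).
rewrite -addrA -opprD [f.@[x] + _]addrC -mevalD -f0E -mevalB.
set F := h - f0 in ho *.
suff -> : F = 0 by rewrite meval0 mZ.
have Fd : (msize F <= d)%N.
  by apply: msize_add => //; rewrite -scaleN1r (leq_trans (msizeZ_le _ _)).
have ELd k l G : (msize G <= d)%N -> (msize (EL k l G) <= d)%N.
  move=> Gd; apply: msize_add; last rewrite -scaleN1r;
    last apply: leq_trans (msizeZ_le _ _) _;
    by apply: msize_sum_le => a _; apply: msize_mulX_deriv.
have Finv y g : Z y -> g \in unitmx -> F.@[ffact g y] = F.@[y].
  move=> Zy gU; rewrite /F !mevalB hinv // f0E !mevalD mZ ?mZ //; last exact: Zact.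
  by rewrite (ffgen_invariant y fP gU).
have ELZ k l y : Z y -> (EL k l F).@[y] = 0.
  by move=> Zy; apply: EL_eq0_of_invariant => g gU; apply: Finv.
have EL0 k l : EL k l F = 0.
  (* The squared norm of [EL k l F] is the product of [F] with [EL l k (EL k l F)]. Since [EL k l F]
     vanishes on the stable set [Z], so does its image under [EL l k]; that image lies in [P], to
     which [F] is orthogonal. *)
  apply: fischer_eq0; rewrite fischer_EL fischerC ho ?rmorph0 //.
  apply: PZ; first by do 2!apply: (ELd).
  move=> y Zy; apply: EL_eq0_of_invariant => g gU.
  by rewrite !ELZ //; apply: Zact.
apply: (invariant_ortho_ffim Fd EL0) => G iG Gd.
by apply: ho; apply: Pim.
Qed.

End FirstFundamentalTheorem.

(** * Substitution in polynomial functions, and removal of one general linear group *)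

Section Polyfun.
Variable K : comNzRingType.

Lemma polyfun_subst (J1 J2 P : Type) (c1 : J1 -> P -> K) (c2 : J2 -> P -> K)
    (S : P -> Prop) f :
  (forall j, exists2 g, polyfun c2 g & forall x, S x -> c1 j x = g x) ->
  polyfun c1 f -> exists2 g, polyfun c2 g & forall x, S x -> f x = g x.
Proof.
move=> c12; elim=> {f} [j|a|f1 f2 _ [g1 P1 E1] _ [g2 P2 E2]
    |f1 f2 _ [g1 P1 E1] _ [g2 P2 E2]|f1 f2 _ [g Pg Eg] f12].
- exact: c12.
- by exists (fun=> a) => //; apply: pf_const.
- by exists (fun x => g1 x + g2 x) => [|x Sx]; [exact: pf_add | rewrite E1 ?E2].
- by exists (fun x => g1 x * g2 x) => [|x Sx]; [exact: pf_mul | rewrite E1 ?E2].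
- by exists g => // x Sx; rewrite -f12 Eg.
Qed.

Lemma polyfun_comp (J1 J2 P1 P2 : Type) (c1 : J1 -> P1 -> K) (c2 : J2 -> P2 -> K)
    (phi : P2 -> P1) f :
  (forall j, polyfun c2 (fun x => c1 j (phi x))) ->
  polyfun c1 f -> polyfun c2 (fun x => f (phi x)).
Proof.
move=> c12; elim=> {f} [j|a|f1 f2 _ P1' _ P2'|f1 f2 _ P1' _ P2'|f1 f2 _ Pg f12].
- exact: c12.
- exact: pf_const.
- exact: pf_add P1' P2'.
- exact: pf_mul P1' P2'.
- by apply: pf_ext Pg _ => x.
Qed.

Lemma polyfun_mpoly (J : finType) (P : Type) (c : J -> P -> K) f :
  polyfun c f ->
  exists F : {mpoly K[#|J|]}, forall x, f x = F.@[fun i => c (enum_val i) x].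
Proof.
elim=> {f} [j|a|f1 f2 _ [F1 E1] _ [F2 E2]|f1 f2 _ [F1 E1] _ [F2 E2]
   |f1 f2 _ [F EF] f12].
- by exists 'X_(enum_rank j) => x; rewrite mevalXU enum_rankK.
- by exists a%:MP => x; rewrite mevalC.
- by exists (F1 + F2) => x; rewrite mevalD E1 E2.
- by exists (F1 * F2) => x; rewrite mevalM E1 E2.
- by exists F => x; rewrite -f12.
Qed.

Definition sumfam (J Y P : Type) (c : J -> P -> K) (y : Y -> P -> K) (j : J + Y) :=
  match j with inl j => c j | inr l => y l end.

(** A polynomial expression involves finitely many members of [y]; this brings the infinite
    coordinate family of the quiver variety within reach of [mpoly]. *)
Lemma polyfun_finite (J Y P : Type) (c : J -> P -> K) (y : Y -> P -> K) f :
  polyfun (sumfam c y) f ->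
  exists N (phi : 'I_N -> Y), polyfun (sumfam c (fun l => y (phi l))) f.
Proof.
pose phi0 : 'I_0 -> Y := fun i => match notF (ltn_ord i) with end.
have cat N1 N2 (phi1 : 'I_N1 -> Y) (phi2 : 'I_N2 -> Y) f1 f2 :
    polyfun (sumfam c (fun l => y (phi1 l))) f1 ->
    polyfun (sumfam c (fun l => y (phi2 l))) f2 ->
    exists N (phi : 'I_N -> Y), polyfun (sumfam c (fun l => y (phi l))) f1 /\
      polyfun (sumfam c (fun l => y (phi l))) f2.
  move=> P1 P2; exists (N1 + N2)%N.
  exists (fun i => match split i with inl i => phi1 i | inr i => phi2 i end).
  split; [apply: (polyfun_comp (phi := id)) P1|apply: (polyfun_comp (phi := id)) P2].
  - case=> [j|l]; first exact: (pf_coord _ (inl j)).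
    apply: pf_ext (pf_coord _ (inr (lshift N2 l))) _ => x /=.
    by rewrite (unsplitK (inl l)).
  - case=> [j|l]; first exact: (pf_coord _ (inl j)).
    apply: pf_ext (pf_coord _ (inr (rshift N1 l))) _ => x /=.
    by rewrite (unsplitK (inr l)).
elim=> {f} [[j|l]|a|f1 f2 _ [N1 [phi1 P1]] _ [N2 [phi2 P2]]
   |f1 f2 _ [N1 [phi1 P1]] _ [N2 [phi2 P2]]|f1 f2 _ [N [phi P1]] f12].
- by exists 0%N, phi0; apply: (pf_coord _ (inl j)).
- by exists 1%N, (fun=> l); apply: (pf_coord _ (inr ord0)).
- by exists 0%N, phi0; apply: pf_const.
- have [N [phi [Q1 Q2]]] := cat _ _ _ _ _ _ P1 P2.
  by exists N, phi; apply: pf_add.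
- have [N [phi [Q1 Q2]]] := cat _ _ _ _ _ _ P1 P2.
  by exists N, phi; apply: pf_mul.
- by exists N, phi; apply: pf_ext P1 f12.
Qed.

Definition mxfam (P : Type) (a b : nat) (M : P -> 'M[K]_(a, b))
  (ij : 'I_a * 'I_b) (x : P) : K := M x ij.1 ij.2.

End Polyfun.

(** The first fundamental theorem in the form used at one vertex. It is applied to the set [Z] of
    coordinate vectors of points of [S]; the action on [S] only has to be known through its effect
    on the coordinates. *)
Lemma eliminate_GL (C : numClosedFieldType) (P Y : Type) (S : P -> Prop)
    (r p q : nat) (Cm : P -> 'M[C]_(r, p)) (Dm : P -> 'M[C]_(q, r))
    (y : Y -> P -> C) (h : P -> C) :
  polyfun (sumfam (sumfam (mxfam Cm) (mxfam Dm)) y) h ->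
  (forall x g, S x -> g \in unitmx -> exists x',
     [/\ S x', Cm x' = g *m Cm x, Dm x' = Dm x *m invmx g,
         forall l, y l x' = y l x & h x' = h x]) ->
  exists2 h', polyfun (sumfam (mxfam (fun x => Dm x *m Cm x)) y) h' &
    forall x, S x -> h x = h' x.
Proof.
move=> /polyfun_finite[N [phi /polyfun_mpoly[F hF]]] Sact.
pose cs x : 'I_#|ffvar r p q N| -> C := fun i =>
  sumfam (sumfam (mxfam Cm) (mxfam Dm)) (fun l => y (phi l)) (enum_val i) x.
have csact x g : S x -> g \in unitmx ->
    exists x', [/\ S x', ffact g (cs x) = cs x' & h x' = h x].
  move=> Sx gU; have [x' [Sx' CE DE yE hE]] := Sact x g Sx gU.
  exists x'; split=> //; apply: funext => v.
  elim/ffvarP: v => [k j|i k|l]; rewrite ?ffactC ?ffactD ?ffactY.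
  - rewrite /cs enum_rankK /= /mxfam CE mxE; apply: eq_bigr => l _.
    by rewrite enum_rankK.
  - rewrite /cs enum_rankK /= /mxfam DE mxE; apply: eq_bigr => l _.
    by rewrite enum_rankK.
  - by rewrite /cs enum_rankK /= yE.
pose Z v := exists2 x, S x & v = cs x.
have [||f fP Ff] := @invariant_on_ffim _ r p q N Z F.
- move=> _ g [x Sx ->] gU; have [x' [Sx' -> _]] := csact x g Sx gU.
  by exists x'.
- move=> _ g [x Sx ->] gU; have [x' [Sx' -> hE]] := csact x g Sx gU.
  by rewrite -!hF.
exists (fun x => f.@[cs x]); last by move=> x Sx; rewrite hF Ff //; exists x.
apply: polyfun_comp fP => -[[i j]|l].
- apply: pf_ext (pf_coord _ (inl (i, j))) _ => x /=.
  by rewrite /mxfam mxE; apply: eq_bigr => k _; rewrite /cs !enum_rankK.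
- by apply: pf_ext (pf_coord _ (inr (phi l))) _ => x /=; rewrite /cs enum_rankK.
Qed.

(** * The quotient map of the quiver variety *)

Section PolynomialMatrices.
Variables (K : comNzRingType) (J P : Type) (c : J -> P -> K).

Definition polymx a b (M : P -> 'M[K]_(a, b)) :=
  forall i j, polyfun c (fun x => M x i j).

Lemma polymx_const a b (M : 'M[K]_(a, b)) : polymx (fun=> M).
Proof. by move=> i j; apply: pf_const. Qed.

Lemma polymx_mul a b e (M : P -> 'M_(a, b)) (M' : P -> 'M_(b, e)) :
  polymx M -> polymx M' -> polymx (fun x => M x *m M' x).
Proof.
move=> MP MP' i j.
have : polyfun c (fun x => \sum_k M x i k * M' x k j).
  by apply: polyfun_sum => k _; apply: pf_mul.
by move/pf_ext; apply => x; rewrite mxE.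
Qed.

Lemma polyfun_det a (M : P -> 'M_a) : polymx M -> polyfun c (fun x => \det (M x)).
Proof.
move=> MP; apply: polyfun_sum => s _; apply: pf_mul (pf_const _ _) _.
by apply: polyfun_prod => i _; apply: MP.
Qed.

End PolynomialMatrices.

Lemma polyfun_factor (K : comNzRingType) (J P1 P2 : Type) (c : J -> P2 -> K)
    (phi : P1 -> P2) f : polyfun (fun j x => c j (phi x)) f ->
  exists2 g, polyfun c g & forall x, f x = g (phi x).
Proof.
elim=> {f} [j|a|f1 f2 _ [g1 P1' E1] _ [g2 P2' E2]
    |f1 f2 _ [g1 P1' E1] _ [g2 P2' E2]|f1 f2 _ [g Pg Eg] f12].
- by exists (c j) => //; apply: pf_coord.
- by exists (fun=> a) => //; apply: pf_const.
- by exists (fun x => g1 x + g2 x) => [|x]; [exact: pf_add | rewrite E1 E2].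
- by exists (fun x => g1 x * g2 x) => [|x]; [exact: pf_mul | rewrite E1 E2].
- by exists g => // x; rewrite -f12.
Qed.

Section QuotientMap.
Variables (C : numClosedFieldType) (d : nat -> nat) (t' : nat) (I : pred nat).
Let t := t'.+1.
Implicit Types (x : LamPt C d) (g : forall i, 'M[C]_(d i)).

(** [Lambda] for an arbitrary dimension vector, with t a successor so that A_(t-1) B_(t-1) is typed
    as an endomorphism of U_t. *)
Definition quiver_var x : Prop :=
  let u := x.1.1 in let A := x.1.2 in let B := x.2 in
  [/\ (forall i, (t < i)%N -> u i = 0),
      (forall i, (t <= i)%N -> A i = 0 /\ B i = 0),
      (forall i, (i.+1 < t)%N -> B i.+1 *m A i.+1 = A i *m B i),
      (forall i, (i < t)%N -> I i -> B i *m u i.+1 = u i) &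
      (forall i, (i < t)%N -> ~~ I i -> A i *m u i = u i.+1)].

Definition quiver_proj x : VEnd C (d t) := (x.1.1 t, x.1.2 t' *m x.2 t').

Definition quiver_act g x : LamPt C d :=
  ((fun i => g i *m x.1.1 i, fun i => g i.+1 *m x.1.2 i *m invmx (g i)),
   fun i => g i *m x.2 i *m invmx (g i.+1)).

Lemma quiver_act_var g x : (forall i, g i \in unitmx) ->
  quiver_var x -> quiver_var (quiver_act g x).
Proof.
move=> gU [u0 AB0 ABE uI uA]; split=> /= i.
- by move/u0 => ->; rewrite mulmx0.
- by move/AB0 => [-> ->]; rewrite !mulmx0 !mul0mx.
- move/ABE => E; rewrite !mulmxA !mulmxKV ?gU //.
  by congr (_ *m _); rewrite -!mulmxA E.
- by move=> it /(uI i it) E; rewrite mulmxA mulmxKV ?gU // -mulmxA E.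
- by move=> it /(uA i it) E; rewrite mulmxA mulmxKV ?gU // -mulmxA E.
Qed.

Lemma quiver_act_proj g x : (forall i, g i \in unitmx) ->
  quiver_proj (quiver_act g x) =
  (g t *m x.1.1 t, g t *m (x.1.2 t' *m x.2 t') *m invmx (g t)).
Proof.
by move=> gU; rewrite /quiver_proj /= !mulmxA mulmxKV ?gU.
Qed.

Lemma polyfun_quiver_act g f : polyfun (@Lam_coord C d) f ->
  polyfun (@Lam_coord C d) (fun x => f (quiver_act g x)).
Proof.
have uP i : polymx (@Lam_coord C d) (fun x => x.1.1 i).
  move=> k j; apply: pf_ext (pf_coord _ (inl (inl (existT _ i k)))) _ => x.
  by rewrite ord1.
have AP i : polymx (@Lam_coord C d) (fun x => x.1.2 i).
  by move=> k j; apply: (pf_coord _ (inl (inr (existT _ i (k, j))))).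
have BP i : polymx (@Lam_coord C d) (fun x => x.2 i).
  by move=> k j; apply: (pf_coord _ (inr (existT _ i (k, j)))).
apply: polyfun_comp => -[[[i k]|[i [k j]]]|[i [k j]]] /=.
- exact: (polymx_mul (polymx_const _ _) (uP i)).
- exact: (polymx_mul (polymx_mul (polymx_const _ _) (AP i)) (polymx_const _ _)).
- exact: (polymx_mul (polymx_mul (polymx_const _ _) (BP i)) (polymx_const _ _)).
Qed.

(** Arrows are counted at their lower end: level i consists of u_i and of the two maps between U_i
    and U_(i+1). *)
Definition Lam_level (j : LamIdx d) : nat :=
  match j with
  | inl (inl (existT i _)) => i
  | inl (inr (existT i _)) => i
  | inr (existT i _) => i
  end.

(** Lower coordinates are set to 0 rather than removed, which keeps one index type throughout the
    elimination. *)
Definition coord_above (i : nat) (j : LamIdx d) x : C :=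
  if (i <= Lam_level j)%N then Lam_coord j x else 0.

Definition coord_proj j x : C := VEnd_coord j (quiver_proj x).

(** Vertices are removed in the order 0, 1, ..., t - 1. Once the levels below i are gone, GL(U_i)
    acts on u_i and the columns of B_i as vectors and on the rows of A_i as covectors. The
    contractions A_i u_i and A_i B_i are then expressed through higher levels and the projection. *)
Lemma quiver_invariant_poly h : polyfun (@Lam_coord C d) h ->
  (forall x g, quiver_var x -> (forall i, g i \in unitmx) -> g t = 1%:M ->
     h (quiver_act g x) = h x) ->
  exists2 f, polyfun (@VEnd_coord C (d t)) f &
    forall x, quiver_var x -> h x = f (quiver_proj x).
Proof.
move=> hP hinv.
have step i : (i <= t)%N ->
    exists2 f, polyfun (sumfam coord_proj (coord_above i)) f &
      forall x, quiver_var x -> h x = f x.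
  elim: i => [_|i IH it].
    exists h => //; apply: (polyfun_comp (phi := id)) hP => j.
    exact: (pf_coord (sumfam _ _) (inr j)).
  have [f fP hf] := IH (ltnW it).
  pose Cm x := row_mx (x.1.1 i) (x.2 i).
  pose Dm x := x.1.2 i.
  pose y := sumfam coord_proj (coord_above i.+1).
  have fP' : polyfun (sumfam (sumfam (mxfam Cm) (mxfam Dm)) y) f.
    apply: (polyfun_comp (phi := id)) fP => -[j|j].
      exact: (pf_coord _ (inr (inl j))).
    rewrite /= /coord_above.
    have [lt_ij|] := ltnP i (Lam_level j).
      rewrite (ltnW lt_ij); apply: pf_ext (pf_coord _ (inr (inr j))) _ => x.
      by rewrite /= /coord_above lt_ij.
    case: ltngtP => // [_ _|ij _]; first exact: pf_const.
    case: j ij => [[[k' k]|[k' [k j]]]|[k' [k j]]] /= /esym ik.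
    - case: k' / ik k => k.
      apply: pf_ext (pf_coord _ (inl (inl (k, lshift _ ord0)))) _ => x.
      by rewrite /= /mxfam row_mxEl.
    - case: k' / ik k j => k j; exact: (pf_coord _ (inl (inr (k, j)))).
    - case: k' / ik k j => k j.
      apply: pf_ext (pf_coord _ (inl (inl (k, rshift _ j)))) _ => x.
      by rewrite /= /mxfam row_mxEr.
  have [x g Sx gU|f' f'P ff'] := eliminate_GL (S := quiver_var) fP'.
    (* Acting at the vertex i alone moves only coordinates of levels i - 1 and i, and the former no
       longer occur in [f]. *)
    pose g' := @dfwith nat (fun k => 'M[C]_(d k)) (fun=> 1%:M) i g.
    have g'i : g' i = g by rewrite /g' dfwith_in.
    have g'o k : i != k -> g' k = 1%:M by move=> ik; rewrite /g' dfwith_out.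
    have g'U k : g' k \in unitmx.
      by have [<-|/g'o ->] := eqVneq i k; rewrite ?g'i ?unitmx1.
    have g't : g' t = 1%:M by rewrite g'o // ltn_eqF.
    have Sx' := quiver_act_var g'U Sx.
    exists (quiver_act g' x); split=> //.
    - by rewrite /Cm /= g'i g'o ?ltn_eqF // invmx1 mulmx1 mul_mx_row.
    - by rewrite /Dm /= g'i g'o ?ltn_eqF // mul1mx.
    - have above k : (i < k)%N -> g' k = 1%:M by move=> ik; rewrite g'o ?ltn_eqF.
      move=> [j|j]; rewrite /y /=.
        by rewrite /coord_proj quiver_act_proj // g't invmx1 !mul1mx mulmx1.
      rewrite /coord_above; case: ltnP => //.
      case: j => [[[k a]|[k [a b]]]|[k [a b]]] /= ik;
        rewrite ?(above k) ?(above k.+1) ?ltnS ?(ltnW ik) //;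
        by rewrite ?invmx1 ?mul1mx ?mulmx1.
    - by rewrite -!hf // hinv.
  have uP k : (i < k)%N -> polymx y (fun x => x.1.1 k).
    move=> ik a b; apply: pf_ext (pf_coord _ (inr (inl (inl (existT _ k a))))) _ => x.
    by rewrite /y /= /coord_above /= ik (ord1 b).
  have AP k : (i < k)%N -> polymx y (fun x => x.1.2 k).
    move=> ik a b.
    apply: pf_ext (pf_coord _ (inr (inl (inr (existT _ k (a, b)))))) _ => x.
    by rewrite /y /= /coord_above /= ik.
  have BP k : (i < k)%N -> polymx y (fun x => x.2 k).
    move=> ik a b.
    apply: pf_ext (pf_coord _ (inr (inr (existT _ k (a, b))))) _ => x.
    by rewrite /y /= /coord_above /= ik.
  (* A_i B_i equals B_(i+1) A_(i+1), or, for i = t - 1, is the second component of the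
     projection. *)
  have [M MP ME] : exists2 M, polymx y M &
      forall x, quiver_var x -> x.1.2 i *m x.2 i = M x.
    move: it; rewrite ltnS leq_eqVlt => /orP[/eqP it|it].
      exists (fun x => x.1.2 i *m x.2 i) => // a b.
      rewrite it in a b *.
      exact: (pf_coord _ (inl (inr (a, b)))).
    exists (fun x => x.2 i.+1 *m x.1.2 i.+1).
      by apply: polymx_mul; [apply: BP | apply: AP].
    by move=> x [_ _ E _ _]; rewrite E.
  have [g gP fg] : exists2 g, polyfun y g & forall x, quiver_var x -> f' x = g x.
    apply: polyfun_subst f'P => -[[a b]|j]; last first.
      by exists (y j) => //; apply: pf_coord.
    rewrite /= /mxfam /Dm /Cm -(splitK b).
    case: (split b) => {}b /=; last first.
      exists (fun x => M x a b) => // x Sx.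
      by rewrite mul_mx_row row_mxEr ME.
    (* A_i u_i is A_i B_i u_(i+1) when i is in [I], and u_(i+1) otherwise. *)
    have [iI|nI] := boolP (I i).
      exists (fun x => (M x *m x.1.1 i.+1) a b).
        exact: (polymx_mul MP (uP _ (ltnSn i))).
      move=> x Sx; rewrite mul_mx_row row_mxEl -(ME x Sx) -mulmxA.
      by case: Sx => _ _ _ E _; rewrite E.
    exists (fun x => x.1.1 i.+1 a b); first exact: uP.
    move=> x [_ _ _ _ E]; rewrite mul_mx_row row_mxEl E //.
  by exists g => // x Sx; rewrite hf // ff' // fg.
have [f fP hf] := step t (leqnn t).
(* From level t on, all coordinates but those of u_t vanish on the variety, and u_t is part of the
   projection. *)
have [g gP fg] : exists2 g, polyfun coord_proj g &
    forall x, quiver_var x -> f x = g x.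
  apply: polyfun_subst fP => -[j|j]; first by exists (coord_proj j) => //; apply: pf_coord.
  rewrite /= /coord_above; case: (boolP (t <= Lam_level j)%N) => [|_]; last first.
    by exists (fun=> 0); [exact: (pf_const _ 0)|].
  case: j => [[[k a]|[k [a b]]]|[k [a b]]] /=.
  - rewrite leq_eqVlt => /orP[/eqP tk|tk].
      case: k / tk a => a; exists (coord_proj (inl a)) => //; exact: pf_coord.
    exists (fun=> 0); first exact: pf_const.
    by move=> x [E _ _ _ _]; rewrite E // mxE.
  - move=> tk; exists (fun=> 0); first exact: pf_const.
    by move=> x [_ E _ _ _]; rewrite (E k tk).1 mxE.
  - move=> tk; exists (fun=> 0); first exact: pf_const.
    by move=> x [_ E _ _ _]; rewrite (E k tk).2 mxE.
have [f' f'P gE] := polyfun_factor gP.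
by exists f' => // x Sx; rewrite hf // fg // gE.
Qed.

End QuotientMap.

(** * Transfer of normality along the projection *)

Section NormalityTransfer.
Variables (C : numClosedFieldType) (d : nat -> nat) (t' : nat) (I : pred nat).
Let t := t'.+1.
Let Lam := @quiver_var C d t' I.
Let proj := @quiver_proj C d t'.
Variable O : VEnd C (d t) -> Prop.

Lemma polyfun_quiver_proj f : polyfun (@VEnd_coord C (d t)) f ->
  polyfun (@Lam_coord C d) (fun x => f (proj x)).
Proof.
apply: polyfun_comp => -[a|[a b]] /=.
- exact: (pf_coord _ (inl (inl (existT _ t a)))).
- apply: polymx_mul => i j.
  + exact: (pf_coord _ (inl (inr (existT _ t' (i, j))))).
  + exact: (pf_coord _ (inr (existT _ t' (i, j)))).
Qed.

(** If [f] vanishes on [O], the product of [f (proj x)] and [g x] is zero on [Lam]; irreducibility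
    removes the factor [g]. *)
Lemma proj_zclosure_generic g :
  normal_var (@Lam_coord C d) Lam -> polyfun (@Lam_coord C d) g ->
  (exists x, Lam x /\ g x != 0) ->
  (forall x, Lam x -> g x != 0 -> zclosure (@VEnd_coord C (d t)) O (proj x)) ->
  forall x, Lam x -> zclosure (@VEnd_coord C (d t)) O (proj x).
Proof.
move=> [_ dom _] gP [x0 [Lx0 gx0]] gO x Lx f fP fO.
have [] := dom _ _ (polyfun_quiver_proj fP) gP.
- move=> y Ly; have [->|gy] := eqVneq (g y) 0; first by rewrite mulr0.
  by rewrite (gO y Ly gy f fP fO) mul0r.
- exact.
- by move/(_ _ Lx0)/eqP; rewrite (negPf gx0).
Qed.

(* A quotient of functions on the closure of [O] that is integral there pulls
   back to a regular function on the quiver variety, which is invariant because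
   the quotient is, so it descends. *)
Lemma normal_zclosure :
  normal_var (@Lam_coord C d) Lam ->
  (forall p, O p -> exists2 x, Lam x & proj x = p) ->
  (forall x, Lam x -> zclosure (@VEnd_coord C (d t)) O (proj x)) ->
  normal_var (@VEnd_coord C (d t)) (zclosure (@VEnd_coord C (d t)) O).
Proof.
set X := zclosure _ O => -[[x0 Lx0] dom int] lift projX.
have polyX f : polyfun (@VEnd_coord C (d t)) f ->
    (forall x, Lam x -> f (proj x) = 0) -> forall p, X p -> f p = 0.
  move=> fP f0 p Xp; apply: (Xp f fP) => q Oq.
  by have [x Lx <-] := lift q Oq; apply: f0.
split; first by exists (proj x0); apply: projX.
  move=> f g fP gP fg.
  have [|f0|g0] := dom _ _ (polyfun_quiver_proj fP) (polyfun_quiver_proj gP).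
  - by move=> x Lx; apply: fg; apply: projX.
  - by left; apply: polyX.
  - by right; apply: polyX.
move=> f g fP gP [p [Xp gp]] [e [a [aP aE]]].
have [y [Ly gy]] : exists x, Lam x /\ g (proj x) != 0.
  apply: contrapT => ng; case/eqP: gp; apply: (polyX g gP) Xp => x Lx.
  by apply/eqP; apply: contra_notT ng => gx; exists x.
have [|h [hP hE]] := int _ _ (polyfun_quiver_proj fP) (polyfun_quiver_proj gP)
    (ex_intro _ y (conj Ly gy)).
  exists e, (fun i x => a i (proj x)); split; first by move=> i; apply: polyfun_quiver_proj.
  by move=> x Lx; apply: aE; apply: projX.
(* [h] is known to be f / g only where g does not vanish; the difference of [h] and its translate is
   therefore multiplied by g, and irreducibility removes that factor. *)
have hinv x g' : Lam x -> (forall i, g' i \in unitmx) -> g' t = 1%:M ->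
    h (quiver_act g' x) = h x.
  move=> Lx gU g1.
  have projE z : proj (quiver_act g' z) = proj z.
    by rewrite /proj quiver_act_proj // g1 invmx1 !mul1mx mulmx1.
  pose k z := h (quiver_act g' z) + - 1 * h z.
  have kP : polyfun (@Lam_coord C d) k.
    by apply: pf_add (polyfun_quiver_act _ hP) (pf_mul (pf_const _ _) hP).
  have [z Lz|k0|g0] := dom _ _ kP (polyfun_quiver_proj gP).
  - rewrite /k mulrDl mulN1r mulNr -hE // -{1}(projE z) -hE ?projE ?subrr //.
    exact: quiver_act_var.
  - by apply/eqP; rewrite -subr_eq0 -mulN1r; apply/eqP/k0.
  - by move: (g0 y Ly) gy => ->; rewrite eqxx.
have [h' h'P hh'] := quiver_invariant_poly hP hinv.
exists h'; split=> // q Xq; apply/eqP; rewrite -subr_eq0 -mulN1r; apply/eqP.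
apply: (polyX (fun q => f q + -1 * (h' q * g q))) Xq.
  exact: pf_add fP (pf_mul (pf_const _ _) (pf_mul h'P gP)).
by move=> x Lx; rewrite -hh' // mulN1r hE // subrr.
Qed.

End NormalityTransfer.

(** * The standard point of the quiver variety *)

Section ConjugateFactorizations.
Variable K : fieldType.

Lemma row_free_conj m n (B B' : 'M[K]_(m, n)) : row_free B -> row_free B' ->
  exists2 S, S \in unitmx & B' *m S = B.
Proof.
move=> fB fB'; have full (D : 'M_(m, n)) : row_free D -> row_full D^T.
  by rewrite /row_full mxrank_tr.
have /eqmxMunitP[S SU E] : (B^T == B'^T)%MS by rewrite !submx_full ?full.
by exists S^T; rewrite ?unitmx_tr // -[B]trmxK E trmx_mul trmxK.
Qed.

(** Modulo the row space of [X], both [Y] and [Y'] span everything, so [Y'] is [W *m Y] plus a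
    combination [D *m X], with [W] invertible; [Q] is the resulting lower block triangular
    matrix. *)
Lemma col_mx_conj m s (X : 'M[K]_m) (Y Y' : 'M_(s, m)) :
  row_full (col_mx X Y) -> row_full (col_mx X Y') ->
  exists2 Q, Q \in unitmx &
    row_mx 1%:M 0 *m Q = row_mx 1%:M 0 :> 'M_(m, m + s) /\
    Q *m col_mx X Y = col_mx X Y'.
Proof.
move=> fY fY'; pose k := cokermx X.
have sub Z : row_full (col_mx X Z) -> (Z *m k == k)%MS.
  case/row_fullP => L; rewrite -[L]hsubmxK mul_row_col => LE.
  apply/andP; split; first exact: submxMl.
  rewrite -[k in (k <= _)%MS]mul1mx -LE mulmxDl -!mulmxA mulmx_coker.
  by rewrite mulmx0 add0r submxMl.
have /eqmxMunitP[W WU WE] : (Y' *m k == Y *m k)%MS.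
  have /eqmxP e := sub _ _ fY; have /eqmxP e' := sub _ _ fY'.
  exact/eqmxP/(eqmx_trans e' (eqmx_sym e)).
have /submxP[D DE] : (Y' - W *m Y <= X)%MS.
  by rewrite submxE mulmxBl -mulmxA -WE subrr.
exists (block_mx 1%:M 0 D W).
  by rewrite unitmxE det_lblock det1 mul1r -unitmxE.
split; first by rewrite mul_row_block !mul1mx !mul0mx !addr0.
by rewrite mul_block_col mul1mx mul0mx addr0 -DE subrK.
Qed.

(** Changes of basis of the middle space put [B] and [B'] in the form (1 0). The upper blocks of [A]
    and [A'] are then the common product, and [col_mx_conj] matches the lower blocks while fixing (1
    0). *)
Lemma factorization_conj m n (A A' : 'M[K]_(n, m)) (B B' : 'M_(m, n)) :
  row_full A -> row_full A' -> row_free B -> row_free B' ->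
  B *m A = B' *m A' ->
  exists2 S, S \in unitmx & S *m A = A' /\ B' *m S = B.
Proof.
move=> fA fA' fB fB' BA.
have [s sE] : exists s, n = (m + s)%N.
  by exists (n - m)%N; rewrite subnKC //; move: fB => /eqP <-; exact: rank_leq_col.
move: A A' B B' fA fA' fB fB' BA; rewrite sE => A A' B B' fA fA' fB fB' BA.
have fE : row_free (row_mx 1%:M 0 : 'M[K]_(m, m + s)).
  by apply/row_freeP; exists (col_mx 1%:M 0); rewrite mul_row_col mul1mx mul0mx addr0.
have [S0 S0U S0E] := row_free_conj fB fE.
have [S1 S1U S1E] := row_free_conj fE fB'.
have upE (D : 'M[K]_(m + s, m)) : row_mx 1%:M 0 *m D = usubmx D.
  by rewrite -[D in LHS]vsubmxK mul_row_col mul1mx mul0mx addr0.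
have uE : usubmx (S0 *m A) = usubmx (invmx S1 *m A').
  by rewrite -!upE !mulmxA S0E -S1E mulmxK.
have fM (S : 'M[K]_(m + s)) (D : 'M_(m + s, m)) :
    S \in unitmx -> row_full D -> row_full (S *m D).
  by move=> SU fD; rewrite (eq_row_full (eqmxMfull _ _)) // row_full_unit.
have := fM _ _ S0U fA; have := fM (invmx S1) _ _ fA'.
rewrite unitmx_inv -[S0 *m A]vsubmxK -[invmx S1 *m A']vsubmxK uE => /(_ S1U) f1 f0.
have [Q QU [QE1 QE2]] := col_mx_conj f0 f1.
exists (S1 *m Q *m S0); first by rewrite !unitmx_mul S1U QU.
split; last by rewrite !mulmxA S1E QE1.
rewrite -mulmxA -[S0 *m A]vsubmxK uE -mulmxA QE2 vsubmxK mulmxA mulmxV //.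
by rewrite mul1mx.
Qed.

End ConjugateFactorizations.

Lemma sum_ord_delta (K : pzSemiRingType) N (F : nat -> K) (m : nat) :
  \sum_(q < N) (m == q :> nat)%:R * F q = (m < N)%:R * F m.
Proof.
have [mN|mN] := ltnP m N; last first.
  rewrite mul0r big1 // => q _.
  have /gtn_eqF -> : (q < m)%N := leq_trans (ltn_ord q) mN.
  by rewrite mul0r.
rewrite (bigD1 (Ordinal mN)) //= eqxx big1 ?addr0 // => q /negPf.
by rewrite -val_eqE /= eq_sym => ->; rewrite mul0r.
Qed.

(* In U_i = C^(d i), position d k + a (k < i, a < r k) stands for the Jordan
   basis vector e_(a, i - k), rows being numbered from 0. *)
Section StandardPoint.
Variables (r : nat -> nat) (t' : nat) (I : pred nat).
Let t := t'.+1.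
Hypothesis r_mono : forall i, (i.+1 < t)%N -> (r i <= r i.+1)%N.

Definition dimr i := (\sum_(j < i) r j)%N.
Local Notation d := dimr.

Lemma dimrS i : d i.+1 = (d i + r i)%N.
Proof. exact: big_ord_recr. Qed.

Lemma dimr_mono i j : (i <= j)%N -> (d i <= d j)%N.
Proof.
elim: j => [|j IH]; first by rewrite leqn0 => /eqP ->.
rewrite leq_eqVlt => /orP[/eqP -> //|/IH ij].
by rewrite dimrS (leq_trans ij) ?leq_addr.
Qed.

Lemma r_mono_le i j : (i <= j)%N -> (j < t)%N -> (r i <= r j)%N.
Proof.
elim: j => [|j IH]; first by rewrite leqn0 => /eqP ->.
rewrite leq_eqVlt => /orP[/eqP -> //|ij jt].
by rewrite (leq_trans (IH ij (ltnW jt))) ?r_mono.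
Qed.

Definition blk (p : nat) : nat := find (fun k => p < d k.+1)%N (iota 0 t).
Definition row_of (p : nat) : nat := (p - d (blk p))%N.
(** The position in U_(i+1) of the basis vector with position p in U_i: same row, next block. *)
Definition shift (p : nat) : nat := (p + r (blk p))%N.

Lemma blkP p : (p < d t)%N -> (blk p < t)%N /\ (d (blk p) <= p < d (blk p).+1)%N.
Proof.
move=> pt; have hasp : has (fun k => p < d k.+1)%N (iota 0 t).
  by apply/hasP; exists t'; [rewrite mem_iota add0n /t ltnSn | exact: pt].
have bt : (blk p < t)%N by rewrite /blk -[X in (_ < X)%N](size_iota 0 t) -has_find.
split=> //; have := nth_find 0%N hasp; rewrite -/(blk p) nth_iota // add0n => ->.
rewrite andbT; case E: (blk p) => [|k]; first by rewrite /d big_ord0.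
have := @before_find _ 0%N (fun k => p < d k.+1)%N (iota 0 t) k.
rewrite -/(blk p) E ltnSn => /(_ isT); rewrite nth_iota ?add0n; last first.
  by rewrite -E ltnW.
by move/negbT; rewrite -leqNgt.
Qed.

Lemma blk_row p : (p < d t)%N -> p = (d (blk p) + row_of p)%N.
Proof. by move=> /blkP[_ /andP[le _]]; rewrite /row_of subnKC. Qed.

Lemma row_lt p : (p < d t)%N -> (row_of p < r (blk p))%N.
Proof.
move=> pt; have [_ /andP[_]] := blkP pt.
by rewrite {1}(blk_row pt) dimrS ltn_add2l.
Qed.

Lemma blk_lt i p : (i <= t)%N -> (p < d i)%N -> (blk p < i)%N.
Proof.
move=> it pi; have pt := leq_trans pi (dimr_mono it).
rewrite ltnNge; apply/negP => ib; have [_ /andP[dp _]] := blkP pt.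
by have := leq_trans pi (leq_trans (dimr_mono ib) dp); rewrite ltnn.
Qed.

Lemma pos_lt i k a : (k < i)%N -> (a < r k)%N -> (d k + a < d i)%N.
Proof.
move=> ki ak; apply: leq_trans (dimr_mono ki).
by rewrite dimrS ltn_add2l.
Qed.

Lemma blk_pos k a : (k < t)%N -> (a < r k)%N -> blk (d k + a) = k.
Proof.
move=> kt ak; have pt := pos_lt kt ak.
have [bt /andP[le lt]] := blkP pt.
apply/eqP; rewrite eqn_leq -ltnS blk_lt ?pos_lt //=.
rewrite leqNgt; apply/negP => bk.
have := leq_trans lt (dimr_mono bk).
by rewrite ltnNge leq_addr.
Qed.

Lemma row_pos k a : (k < t)%N -> (a < r k)%N -> row_of (d k + a) = a.
Proof. by move=> kt ak; rewrite /row_of blk_pos // addKn. Qed.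

Lemma pos_inj p q : (p < d t)%N -> (q < d t)%N ->
  blk p = blk q -> row_of p = row_of q -> p = q.
Proof. by move=> pt qt b rw; rewrite (blk_row pt) (blk_row qt) b rw. Qed.

Lemma shiftE i p : (i < t)%N -> (p < d i)%N ->
  [/\ shift p = (d (blk p).+1 + row_of p)%N, (shift p < d i.+1)%N,
      blk (shift p) = (blk p).+1 & row_of (shift p) = row_of p].
Proof.
move=> it pi; have pt := leq_trans pi (dimr_mono (ltnW it)).
have bi := blk_lt (ltnW it) pi.
have b1 : ((blk p).+1 < t)%N := leq_ltn_trans bi it.
have sE : shift p = (d (blk p).+1 + row_of p)%N.
  by rewrite /shift {1}(blk_row pt) dimrS addnAC.
have rw : (row_of p < r (blk p).+1)%N.
  exact: leq_trans (row_lt pt) (r_mono b1).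
by split; rewrite // sE ?blk_pos ?row_pos // pos_lt.
Qed.

Lemma shift_inj i p q : (i < t)%N -> (p < d i)%N -> (q < d i)%N ->
  shift p = shift q -> p = q.
Proof.
move=> it pi qi E; have [_ _ bp rp] := shiftE it pi; have [_ _ bq rq] := shiftE it qi.
have dt := dimr_mono (ltnW it).
apply: pos_inj; rewrite ?(leq_trans _ dt) //; first by apply: succn_inj; rewrite -bp E.
by rewrite -rp E.
Qed.

Lemma shift_lt i p : (i < t)%N -> (p < d i.+1)%N -> (shift p < d i.+1)%N -> (p < d i)%N.
Proof.
move=> it pi; apply: contraTT; rewrite -!leqNgt => ip.
have [_ /andP[_ lt]] := blkP (leq_trans pi (dimr_mono it)).
have : (i <= blk p)%N.
  by rewrite leqNgt; apply/negP => bi; have := leq_trans lt (leq_trans (dimr_mono bi) ip);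
     rewrite ltnn.
have := blk_lt it pi; rewrite ltnS => bi ib.
have bE : blk p = i by apply/eqP; rewrite eqn_leq bi.
by rewrite /shift bE dimrS leq_add2r.
Qed.

Lemma shift_surj k a : (k.+1 < t)%N -> (a < r k)%N -> shift (d k + a) = (d k.+1 + a)%N.
Proof.
move=> kt ak; have pi : (d k + a < d k.+1)%N := pos_lt (ltnSn k) ak.
by have [-> _ _ _] := shiftE kt pi; rewrite blk_pos ?row_pos // ltnW.
Qed.

(** For i = t this will be the part of mu in row a; smaller i give its analogue for the first i
    columns. *)
Definition cnt i a := (\sum_(j < i) (I j && (a < r j)))%N.

Lemma cntS i a : cnt i.+1 a = (cnt i a + (I i && (a < r i)))%N.
Proof. exact: big_ord_recr. Qed.

Lemma cnt_le i k a : (k <= i)%N -> (forall j, (j < k)%N -> (r j <= a)%N) ->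
  (k + cnt i a <= i)%N.
Proof.
move=> ki ra; rewrite -(subnKC ki); elim: (i - k)%N => [|m IH].
  rewrite addn0 /cnt big1 ?addn0 // => j _.
  by rewrite ltnNge ra // andbF.
rewrite addnS cntS addnA.
by apply: leq_trans (leq_add IH (leq_b1 _)) _; rewrite addn1.
Qed.

Variable C : numClosedFieldType.

(** On Jordan labels [stdA] keeps each e_(a, j), while [stdB], the identity on positions, lowers j
    by one and kills e_(a, 1), because j = i - k depends on i. *)
Definition stdA i : 'M[C]_(d i.+1, d i) := \matrix_(p, q) (p == shift q :> nat)%:R.
Definition stdB i : 'M[C]_(d i, d i.+1) := \matrix_(p, q) (p == q :> nat)%:R.
(** The sum over a of e_(a, [cnt i a]); rows with count 0 contribute nothing, blocks in U_i being
    below i. *)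
Definition stdu i : 'cV[C]_(d i) :=
  \col_p (i == blk p + cnt i (row_of p))%N%:R.
Definition stdN : 'M[C]_(d t) := stdA t' *m stdB t'.

Lemma stdBE i m (v : 'M_(d i.+1, m)) (p : 'I_(d i)) (q : 'I_(d i.+1)) j : p = q :> nat ->
  (stdB i *m v) p j = v q j.
Proof.
move=> pq; rewrite mxE (bigD1 q) //= mxE pq eqxx mul1r big1 ?addr0 // => b ne.
by rewrite mxE pq val_eqE eq_sym (negPf ne) mul0r.
Qed.

Lemma stdA_shift i m (v : 'M_(d i, m)) (q : 'I_(d i)) (p : 'I_(d i.+1)) j :
  (i < t)%N -> p = shift q :> nat -> (stdA i *m v) p j = v q j.
Proof.
move=> it pq; rewrite mxE (bigD1 q) //= mxE pq eqxx mul1r big1 ?addr0 // => b ne.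
rewrite mxE pq; case: eqP => [/(shift_inj it (ltn_ord _) (ltn_ord _)) e|_].
  by move: ne; rewrite (val_inj e) eqxx.
by rewrite mul0r.
Qed.

Lemma stdA_out i m (v : 'M_(d i, m)) (p : 'I_(d i.+1)) j :
  (forall q : 'I_(d i), p <> shift q :> nat) -> (stdA i *m v) p j = 0.
Proof.
move=> np; rewrite mxE big1 // => q _; rewrite mxE.
by case: eqP => [/np|_]; rewrite ?mul0r.
Qed.

Lemma stdAB i : stdA i *m stdB i =
  \matrix_(p, q) ((p == shift q :> nat) && (q < d i)%N)%:R.
Proof.
apply/matrixP => p q; rewrite !mxE.
rewrite (eq_bigr (fun j : 'I_(d i) => (q == j :> nat)%:R * (p == shift j :> nat)%:R)).
  by rewrite (sum_ord_delta _ (fun j => (p == shift j :> nat)%:R)) -natrM mulnb andbC.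
by move=> j _; rewrite !mxE mulrC [(j == q :> nat)]eq_sym.
Qed.

Lemma stdBA i : (i.+1 < t)%N -> stdB i.+1 *m stdA i.+1 = stdA i *m stdB i.
Proof.
move=> it; rewrite stdAB; apply/matrixP => p q; rewrite [RHS]mxE.
have pi : (p < d i.+2)%N := leq_trans (ltn_ord p) (dimr_mono (leqnSn _)).
rewrite (@stdBE _ _ _ p (Ordinal pi)) // mxE /=; case: eqP => //= e.
by rewrite (shift_lt (ltnW it)) // -e.
Qed.

Lemma stdu_B i : (i < t)%N -> I i -> stdB i *m stdu i.+1 = stdu i.
Proof.
move=> it Ii; apply/matrixP => p j.
have pi : (p < d i.+1)%N := leq_trans (ltn_ord p) (dimr_mono (leqnSn _)).
rewrite (@stdBE _ _ _ p (Ordinal pi)) // !mxE /= cntS Ii.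
have bi := blk_lt (ltnW it) (ltn_ord p).
have pt := leq_trans (ltn_ord p) (dimr_mono (ltnW it)).
by rewrite (leq_trans (row_lt pt) (r_mono_le (ltnW bi) it)) addnA addn1 eqSS.
Qed.

Lemma stdu_A i : (i < t)%N -> ~~ I i -> stdA i *m stdu i = stdu i.+1.
Proof.
move=> it nI; apply/matrixP => p j; rewrite [RHS]mxE cntS (negPf nI) addn0.
have pt := leq_trans (ltn_ord p) (dimr_mono it).
have bi := blk_lt it (ltn_ord p).
have [[q pq]|nq] := EM (exists q : 'I_(d i), p = shift q :> nat).
  rewrite (stdA_shift _ _ it pq) mxE.
  by rewrite pq; have [_ _ -> ->] := shiftE it (ltn_ord q); rewrite addSn eqSS.
rewrite stdA_out; last by move=> q pq; apply: nq; exists q.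
suff /ltn_eqF le : (blk p + cnt i (row_of p) < i.+1)%N by rewrite eq_sym le.
(* A position outside the image of [shift] starts its row: the columns before its block do not reach
   that row, which bounds the count. *)
rewrite ltnS; apply: cnt_le => // k kb; rewrite leqNgt; apply/negP => ak.
case E: (blk p) kb bi => [|b] // kb; rewrite ltnS => bi.
have ab : (row_of p < r b)%N.
  apply: leq_trans ak _; apply: r_mono_le; first by rewrite -ltnS.
  exact: ltn_trans bi it.
have qi : (d b + row_of p < d i)%N by apply: pos_lt.
apply: nq; exists (Ordinal qi) => /=.
by rewrite shift_surj ?(leq_ltn_trans bi it) // -E -blk_row.
Qed.

Definition stdpt : LamPt C d :=
  ((fun i => if (i <= t)%N then stdu i else 0,
    fun i => if (i < t)%N then stdA i else 0),
   fun i => if (i < t)%N then stdB i else 0).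

Lemma stdpt_var : quiver_var t' I stdpt.
Proof.
split=> /= i it.
- by rewrite leqNgt it.
- by rewrite ltnNge it.
- by rewrite it (ltnW it) stdBA.
- by move=> Ii; rewrite it (ltnW it) stdu_B.
- by move=> Ii; rewrite it (ltnW it) stdu_A.
Qed.

Lemma stdBBt i : stdB i *m (stdB i)^T = 1%:M.
Proof.
apply/matrixP => p q.
have pi : (p < d i.+1)%N := leq_trans (ltn_ord p) (dimr_mono (leqnSn _)).
by rewrite (@stdBE _ _ _ p (Ordinal pi)) // !mxE /= val_eqE eq_sym.
Qed.

Lemma stdAtA i : (i < t)%N -> (stdA i)^T *m stdA i = 1%:M.
Proof.
move=> it; apply/matrixP => p q; rewrite !mxE.
have [_ sp _ _] := shiftE it (ltn_ord p).
rewrite (bigD1 (Ordinal sp)) //= !mxE eqxx mul1r big1 ?addr0; last first.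
  by move=> b; rewrite -val_eqE /= => /negPf ne; rewrite !mxE ne mul0r.
rewrite -val_eqE /=; suff -> : (shift p == shift q) = (p == q :> nat) by [].
by apply/eqP/eqP => [|-> //]; apply: (shift_inj it).
Qed.

Lemma stdN_shift p q : stdN p q = ((p == shift q :> nat) && (q < d t')%N)%:R.
Proof. by rewrite /stdN stdAB mxE. Qed.

(** Projection onto one Jordan chain; it commutes with [stdN] and isolates a single summand of
    [stdu t]. *)
Definition rowproj a : 'M[C]_(d t) := \matrix_(p, q) ((p == q) && (row_of p == a))%:R.

Lemma rowprojE a m (v : 'M_(d t, m)) p j :
  (rowproj a *m v) p j = (row_of p == a)%:R * v p j.
Proof.
rewrite mxE (bigD1 p) //= mxE eqxx big1 ?addr0 // => q ne.
by rewrite mxE eq_sym (negPf ne) mul0r.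
Qed.

Lemma rowproj_comm a : rowproj a *m stdN = stdN *m rowproj a.
Proof.
apply/matrixP => p q; rewrite rowprojE [RHS]mxE (bigD1 q) //= [rowproj a q q]mxE eqxx big1.
  rewrite addr0 mulrC stdN_shift; case: eqP => [e|_]; last by rewrite !mul0r.
  have [qt|_] := ltnP q (d t'); last by rewrite !mul0r.
  by rewrite e; have [_ _ _ ->] := shiftE (ltnSn t') qt.
by move=> b ne; rewrite [rowproj _ _ _]mxE (negPf ne) mulr0.
Qed.

Lemma stdN_delta (p q : 'I_(d t)) : (q < d t')%N -> p = shift q :> nat ->
  stdN *m delta_mx q 0 = delta_mx p 0 :> 'cV_(d t).
Proof.
move=> qt pq; rewrite -colE; apply/matrixP => b j.
by rewrite [LHS]mxE stdN_shift mxE ord1 qt andbT -pq val_eqE andbT.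
Qed.

(* The commutant of [stdN] applied to [stdu t] gives every e_(a, j) with
   j <= cnt t a. *)
Lemma commutant_delta (p : 'I_(d t)) : (t <= blk p + cnt t (row_of p))%N ->
  exists2 Q, Q *m stdN = stdN *m Q & Q *m stdu t = delta_mx p 0.
Proof.
have [k] := ubnP (blk p); elim: k p => // k IH p bk.
rewrite leq_eqVlt => /orP[/eqP pt|pt].
  exists (rowproj (row_of p)); first exact: rowproj_comm.
  apply/matrixP => q j; rewrite rowprojE !mxE ord1 andbT -natrM mulnb.
  congr ((nat_of_bool _)%:R); apply/idP/idP => [/andP[/eqP rE]|/eqP ->]; last first.
    by rewrite eqxx {1}pt eqxx.
  rewrite {1}pt rE eqn_add2r => /eqP bE; apply/eqP/val_inj.
  exact: (pos_inj (ltn_ord _) (ltn_ord _)).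
have bt := blk_lt (leqnn t) (ltn_ord p).
(* In the strict case the row also reaches the preceding column, since otherwise [cnt_le] would give
   the opposite inequality. The vector is then [stdN] applied to the one a block earlier. *)
have [b bE rb] : exists2 b, blk p = b.+1 & (row_of p < r b)%N.
  case E: (blk p) => [|b].
    have : (0 + cnt t (row_of p) <= t)%N by apply: cnt_le.
    by rewrite -E leqNgt pt.
  exists b => //; rewrite ltnNge; apply/negP => rb.
  have : (b.+1 + cnt t (row_of p) <= t)%N.
    apply: cnt_le => [|j jb]; first by rewrite -E ltnW.
    by apply: leq_trans rb; apply: r_mono_le => //; rewrite ltnW // -E.
  by rewrite -E leqNgt pt.
have bt' : (b < t')%N by rewrite -ltnS -bE.
have bt2 : (b < t)%N := ltnW bt'.
have qt : (d b + row_of p < d t)%N by rewrite pos_lt.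
have qt' : (d b + row_of p < d t')%N by rewrite pos_lt.
have [||Q QN Qu] := IH (Ordinal qt).
- by rewrite /= blk_pos // -ltnS -bE.
- by rewrite /= blk_pos ?row_pos // -ltnS -addSn -bE.
exists (stdN *m Q); first by rewrite -mulmxA QN.
rewrite -mulmxA Qu; apply: stdN_delta => //=.
by rewrite shift_surj // -bE -blk_row.
Qed.

Lemma commutant_cyclic (c : 'cV[C]_(d t)) :
  (forall p, c p 0 != 0 -> (t <= blk p + cnt t (row_of p))%N) ->
  exists2 Q, Q *m stdN = stdN *m Q & Q *m stdu t = c.
Proof.
move=> cP; have /fin_all_exists[Q QP] p : exists Q : 'M[C]_(d t),
    Q *m stdN = stdN *m Q /\ Q *m stdu t = c p 0 *: delta_mx p 0.
  have [->|/cP/commutant_delta[Q QN Qu]] := eqVneq (c p 0) 0.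
    by exists 0; rewrite !mul0mx mulmx0 scale0r.
  by exists (c p 0 *: Q); rewrite -!scalemxAl -scalemxAr QN Qu.
exists (\sum_p Q p).
  rewrite mulmx_suml mulmx_sumr; apply: eq_bigr => p _.
  exact: (QP p).1.
rewrite mulmx_suml (eq_bigr (fun p => c p 0 *: delta_mx p 0)); last first.
  by move=> p _; exact: (QP p).2.
apply/matrixP => p j; rewrite ord1 summxE (bigD1 p) //= !mxE !eqxx mulr1.
by rewrite big1 ?addr0 // => q ne; rewrite !mxE eq_sym (negPf ne) mulr0.
Qed.

(** The condition reads j <= [cnt i a] for every e_(a, j) occurring in c_i. For i in [I], a vector
    e_(a, j) in c_(i+1) has j = 1 or comes from e_(a, j-1) in c_i, and the count grows by one;
    otherwise [stdA] keeps both j and the count. *)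
Lemma quiver_support (c : forall i, 'cV[C]_(d i)) :
  (forall i, (i < t)%N -> I i -> stdB i *m c i.+1 = c i) ->
  (forall i, (i < t)%N -> ~~ I i -> stdA i *m c i = c i.+1) ->
  forall i, (i <= t)%N -> forall p, c i p 0 != 0 ->
    (i <= blk p + cnt i (row_of p))%N.
Proof.
move=> cI cA; elim=> // i IH it p cp.
have pt := leq_trans (ltn_ord p) (dimr_mono it).
have := blk_lt it (ltn_ord p); rewrite ltnS => bi.
have [Ii|nI] := boolP (I i).
  have rp : (row_of p < r i)%N := leq_trans (row_lt pt) (r_mono_le bi it).
  rewrite cntS Ii rp addnA addn1 ltnS.
  have [pi|ip] := ltnP p (d i).
    have := IH (ltnW it) (Ordinal pi); rewrite -(cI i it Ii).
    by rewrite (stdBE _ (q := p)) //; apply.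
  suff -> : blk p = i by apply: leq_addr.
  apply/eqP; rewrite eqn_leq bi leqNgt; apply/negP => b.
  have [_ /andP[_ lt]] := blkP pt.
  by have := leq_trans lt (leq_trans (dimr_mono b) ip); rewrite ltnn.
move: cp; rewrite -(cA i it nI).
have [[q pq]|nq] := EM (exists q : 'I_(d i), p = shift q :> nat).
  rewrite (stdA_shift _ _ it pq) => /(IH (ltnW it)).
  have [_ _ b rw] := shiftE it (ltn_ord q).
  by rewrite cntS (negPf nI) addn0 pq b rw addSn.
rewrite stdA_out ?eqxx // => q pq; apply: nq; by exists q.
Qed.

Definition std_orbit (p : VEnd C (d t)) : Prop :=
  exists2 T, T \in unitmx &
    p = (T *m stdu t, T *m stdN *m invmx T).

Lemma std_orbit_lift p : std_orbit p ->
  exists2 x, quiver_var t' I x & quiver_proj t' x = p.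
Proof.
move=> [T TU ->].
pose g := @dfwith nat (fun k => 'M[C]_(d k)) (fun=> 1%:M) t T.
have gt : g t = T by rewrite /g dfwith_in.
have gU k : g k \in unitmx.
  have [<-|ne] := eqVneq t k; first by rewrite gt.
  by rewrite /g dfwith_out // unitmx1.
exists (quiver_act g stdpt); first exact: quiver_act_var gU stdpt_var.
by rewrite quiver_act_proj //= !leqnn gt.
Qed.

Lemma polyfun_line (v w : 'cV[C]_(d t)) (X : 'M[C]_(d t)) f :
  polyfun (@VEnd_coord C (d t)) f ->
  exists q : {poly C}, forall s, f (v + s *: w, X) = q.[s].
Proof.
elim=> {f} [[i|ij]|a|f f' _ [q E] _ [q' E']|f f' _ [q E] _ [q' E']|f f' _ [q E] ff'].
- exists ((v i 0)%:P + (w i 0)%:P * 'X) => s.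
  by rewrite !(hornerD, hornerM, hornerC, hornerX) /= !mxE mulrC.
- by exists (X ij.1 ij.2)%:P => s; rewrite hornerC.
- by exists a%:P => s; rewrite hornerC.
- by exists (q + q') => s; rewrite hornerD E E'.
- by exists (q * q') => s; rewrite hornerM E E'.
- by exists q => s; rewrite -ff'.
Qed.

(* With Q (stdu t) = c and Q commuting with stdN, (c + s stdu t, stdN) lies in
   the orbit as soon as Q + s is invertible. *)
Lemma std_closure (T : 'M_(d t)) (c : 'cV_(d t)) : T \in unitmx ->
  (forall p, c p 0 != 0 -> (t <= blk p + cnt t (row_of p))%N) ->
  zclosure (@VEnd_coord C (d t)) std_orbit (T *m c, T *m stdN *m invmx T).
Proof.
move=> TU /commutant_cyclic[Q QN Qu] f fP fO.
have [q qE] := polyfun_line (T *m c) (T *m stdu t) (T *m stdN *m invmx T) fP.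
suff q0 : q = 0.
  by have := qE 0; rewrite q0 horner0 scale0r addr0.
apply: (@poly_eq0_generic _ q (char_poly (- Q))).
  exact/monic_neq0/char_poly_monic.
move=> s; rewrite -[_ == 0]/(root (char_poly (- Q)) s) -eigenvalue_root_char => ns.
have QU : Q + s%:M \in unitmx.
  move: ns; rewrite /eigenvalue negbK /eigenspace kermx_eq0 row_free_unit.
  by rewrite -opprD -scaleN1r unitmxZ ?unitrN1.
have QsN : (Q + s%:M) *m stdN = stdN *m (Q + s%:M).
  by rewrite mulmxDl mulmxDr QN mul_scalar_mx mul_mx_scalar.
rewrite -qE; apply: fO; exists (T *m (Q + s%:M)); first by rewrite unitmx_mul TU.
congr (_, _).
  by rewrite -mulmxA mulmxDl Qu mul_scalar_mx mulmxDr -scalemxAr.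
have WU : T *m (Q + s%:M) \in unitmx by rewrite unitmx_mul TU.
apply: (can_inj (mulmxK WU)); rewrite [in RHS]mulmxKV // mulmxA mulmxKV //.
by rewrite -2!(mulmxA T) QsN.
Qed.

(** The T_i are found one vertex at a time: after conjugation by T_m, the pair (A_m, B_m) and the
    standard pair factor the same endomorphism of U_m, by the relation at the previous vertex, so
    [factorization_conj] supplies T_(m+1). *)
Lemma std_chain (x : LamPt C d) : quiver_var t' I x ->
  (forall i, (i < t)%N -> row_full (x.1.2 i) /\ row_free (x.2 i)) ->
  exists2 T : forall i, 'M[C]_(d i), forall i, T i \in unitmx &
    forall i, (i < t)%N ->
      x.1.2 i *m T i = T i.+1 *m stdA i /\ x.2 i *m T i.+1 = T i *m stdB i.
Proof.
move=> [_ _ AB _ _] full.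
have chain m : (m <= t)%N -> exists2 T : forall i, 'M[C]_(d i),
    forall i, T i \in unitmx & forall i, (i < m)%N ->
      x.1.2 i *m T i = T i.+1 *m stdA i /\ x.2 i *m T i.+1 = T i *m stdB i.
  elim: m => [_|m IH mt]; first by exists (fun=> 1%:M) => // i; rewrite unitmx1.
  have [T TU TE] := IH (ltnW mt).
  have [fA fB] := full m mt.
  have fT : row_full (x.1.2 m *m T m) by rewrite /row_full mxrankMfree ?row_free_unit.
  have fTB : row_free (invmx (T m) *m x.2 m).
    by rewrite /row_free (eqmxMfull _ _) // row_full_unit unitmx_inv.
  have sA : row_full (stdA m) by apply/row_fullP; exists (stdA m)^T; rewrite stdAtA.
  have sB : row_free (stdB m) by apply/row_freeP; exists (stdB m)^T; rewrite stdBBt.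
  have BA : stdB m *m stdA m = invmx (T m) *m x.2 m *m (x.1.2 m *m T m).
    case: m IH mt TE {fA fB fT fTB sA sB} => [_ _ _|m _ mt TE].
      by apply/matrixP => p; have := ltn_ord p; rewrite {2}/d big_ord0.
    have [E1 E2] := TE m (ltnSn m).
    rewrite -mulmxA [x.2 m.+1 *m _]mulmxA AB // -(mulmxA (x.1.2 m)) E2.
    by rewrite (mulmxA (x.1.2 m)) E1 -(mulmxA (T m.+1)) mulKmx // stdBA.
  have [S SU [SA SB]] := factorization_conj sA fT sB fTB BA.
  exists (@dfwith nat (fun k => 'M[C]_(d k)) T m.+1 S) => [i|i].
    by case: dfwithP.
  rewrite ltnS leq_eqVlt => /orP[/eqP ->|im].
    rewrite dfwith_in dfwith_out ?gtn_eqF // SA; split=> //.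
    by rewrite -SB !mulmxA mulmxV // mul1mx.
  rewrite !dfwith_out ?gtn_eqF ?ltnS //; last exact: ltnW.
  exact: TE.
exact: chain t (leqnn t).
Qed.

(** One maximal minor of each map, chosen to be 1 at [stdpt]: a single polynomial cutting out a
    nonempty open set where all the ranks are full. *)
Definition std_minors (x : LamPt C d) : C :=
  \prod_(i < t) (\det (x.2 i *m (stdB i)^T) * \det ((stdA i)^T *m x.1.2 i)).

Lemma std_minors_full x i : std_minors x != 0 -> (i < t)%N ->
  row_full (x.1.2 i) /\ row_free (x.2 i).
Proof.
move=> /prodf_neq0 nz it; have := nz (Ordinal it) isT; rewrite mulf_eq0 negb_or /=.
move=> /andP[nB nA]; split.
  have U : (stdA i)^T *m x.1.2 i \in unitmx by rewrite unitmxE unitfE.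
  by apply/row_fullP; eexists; rewrite -(mulVmx U) mulmxA.
have U : x.2 i *m (stdB i)^T \in unitmx by rewrite unitmxE unitfE.
by apply/row_freeP; eexists; rewrite -(mulmxV U) -mulmxA.
Qed.

Lemma std_minors_poly : polyfun (@Lam_coord C d) std_minors.
Proof.
apply: polyfun_prod => i _; apply: pf_mul; apply: polyfun_det.
  apply: polymx_mul (polymx_const _ _) => a b.
  exact: (pf_coord _ (inr (existT _ (i : nat) (a, b)))).
apply: (polymx_mul (polymx_const _ _)) => a b.
exact: (pf_coord _ (inl (inr (existT _ (i : nat) (a, b))))).
Qed.

Lemma normal_std_orbit : normal_var (@Lam_coord C d) (quiver_var t' I) ->
  normal_var (@VEnd_coord C (d t)) (zclosure (@VEnd_coord C (d t)) std_orbit).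
Proof.
move=> nL; apply: (normal_zclosure nL std_orbit_lift).
apply: (proj_zclosure_generic nL std_minors_poly).
  exists stdpt; split; first exact: stdpt_var.
  apply/prodf_neq0 => i _ /=.
  by rewrite ltn_ord stdBBt stdAtA // !det1 mul1r oner_neq0.
move=> x Lx nz; have [T TU TE] := std_chain Lx (fun i => std_minors_full nz).
case: (Lx) => _ _ _ uI uA.
(* In the coordinates given by T, the vectors u_i satisfy the relations of the standard maps. *)
pose c i := invmx (T i) *m x.1.1 i.
have cI i : (i < t)%N -> I i -> stdB i *m c i.+1 = c i.
  move=> it Ii; rewrite /c -(uI i it Ii) !mulmxA; congr (_ *m _).
  apply: (can_inj (mulmxK (TU i.+1))); rewrite mulmxKV // -mulmxA (TE i it).2.
  by rewrite mulKmx.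
have cA i : (i < t)%N -> ~~ I i -> stdA i *m c i = c i.+1.
  move=> it nI; rewrite /c -(uA i it nI) !mulmxA; congr (_ *m _).
  apply: (can_inj (mulmxK (TU i))); rewrite mulmxKV // -mulmxA (TE i it).1.
  by rewrite mulKmx.
have cP := quiver_support cI cA (leqnn t).
have -> : quiver_proj t' x = (T t *m c t, T t *m stdN *m invmx (T t)).
  congr (_, _); first by rewrite mulKVmx.
  apply: (can_inj (mulmxK (TU t))); rewrite mulmxKV // -mulmxA.
  by rewrite (TE t' (ltnSn t')).2 mulmxA (TE t' (ltnSn t')).1 -mulmxA.
exact: std_closure.
Qed.

End StandardPoint.

(** * Partitions and the orbit *)

Section Partitions.

Lemma part_le p a b : sorted geq p -> (a <= b)%N -> (part p b <= part p a)%N.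
Proof.
move=> sp ab; have [pb|bp] := leqP (size p) b; first by rewrite /part nth_default.
have gt : transitive geq by move=> x y z xy yz; apply: leq_trans yz xy.
have gr : reflexive geq by move=> x; apply: leqnn.
apply: (sorted_leq_nth gt gr 0%N sp); rewrite ?inE //.
exact: leq_ltn_trans ab bp.
Qed.

(** Row and column descriptions of the boxes of a Young diagram, rows being numbered from 0. *)
Lemma lt_count_geq p a j : sorted geq p -> (0 < j)%N ->
  (a < count (fun x => j <= x) p)%N = (j <= part p a)%N.
Proof.
move=> sp j0; elim: p a sp => [|x p IH] a sp.
  by rewrite /part nth_nil ltn0 leqn0 eqn0Ngt j0.
have sp' : sorted geq p := path_sorted sp.
rewrite /part /=; have [jx|jx] := leqP j x; last first.
  rewrite add0n (_ : count _ p = 0%N); last first.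
    apply/eqP; rewrite -leqn0 leqNgt -has_count; apply/hasPn => y yp.
    have : geq x y by move: sp => /(order_path_min _)/allP; apply => //;
      move=> b c e bc ce; apply: leq_trans ce bc.
    by rewrite -ltnNge => yx; apply: leq_ltn_trans yx jx.
  symmetry; apply/negbTE; rewrite -ltnNge.
  by apply: leq_ltn_trans jx; apply: (@part_le (x :: p) 0 a).
case: a => [|a] /=; first by rewrite jx.
by rewrite add1n ltnS IH.
Qed.

Lemma count_iota_leq m M : (m <= M)%N -> count (fun j => j <= m)%N (iota 1 M) = m.
Proof.
move=> mM; rewrite -(subnKC mM) iotaD count_cat.
rewrite (_ : count _ (iota 1 m) = m); last first.
  rewrite -[RHS](size_iota 1 m); apply/eqP; rewrite -all_count; apply/allP => j.
  by rewrite mem_iota add1n ltnS => /andP[].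
rewrite (_ : count _ _ = 0%N) ?addn0 //.
apply/eqP; rewrite -leqn0 leqNgt -has_count; apply/hasPn => j.
by rewrite mem_iota add1n => /andP[mj _]; rewrite -ltnNge.
Qed.

Lemma count_sum (T : Type) (b : pred T) s : count b s = (\sum_(x <- s) b x)%N.
Proof. by elim: s => [|x s IH]; rewrite ?big_nil ?big_cons //= IH. Qed.

Lemma sumn_part p M : (size p <= M)%N -> sumn p = (\sum_(a < M) part p a)%N.
Proof.
move=> pM; rewrite sumnE (big_nth 0%N) -(big_mkord xpredT (part p)) /=.
rewrite [RHS](big_cat_nat (leq0n (size p)) pM) /= [X in (_ + X)%N]big_nat_cond.
rewrite [X in (_ + X)%N]big1 ?addn0 // => a /andP[/andP[pa _] _].
by rewrite /part nth_default.
Qed.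

Variables mu nu : seq nat.
Hypotheses (mu_part : is_partition mu) (nu_part : is_partition nu).
Local Notation lam := (lamseq mu nu).
Local Notation t := (tlen mu nu).
Local Notation r := (rcol mu nu).

Lemma part_lam a : part lam a = (part mu a + part nu a)%N.
Proof.
rewrite /part /lamseq.
have [am|ma] := ltnP a (maxn (size mu) (size nu)).
  by rewrite (nth_map 0%N) ?size_iota // nth_iota.
rewrite nth_default ?size_map ?size_iota //.
by move: ma; rewrite geq_max => /andP[? ?]; rewrite !nth_default.
Qed.

Lemma lam_sorted : sorted geq lam.
Proof.
have [/andP[sm _] /andP[sn _]] := (mu_part, nu_part).
apply/(sortedP 0%N) => i _; rewrite -!/(part _ _) !part_lam.
by apply: leq_add; apply: part_le.
Qed.

Lemma tlenE : t = part lam 0.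
Proof. by rewrite /tlen /part nth0. Qed.

Lemma part_lam_le a : (part lam a <= t)%N.
Proof. by rewrite tlenE part_le // lam_sorted. Qed.

Lemma rcolE k : (k < t)%N -> r k = count (fun x => t - k <= x)%N lam.
Proof.
move=> kt; rewrite /rcol /conjseq -/t.
rewrite (nth_map 0%N) ?size_iota ?ltn_subrL ?(leq_ltn_trans _ kt) //.
rewrite nth_iota ?ltn_subrL ?(leq_ltn_trans _ kt) //.
by apply: eq_count => x; rewrite add1n subnSK.
Qed.

Lemma lt_rcol k a : (k < t)%N -> (a < r k)%N = (t - k <= part lam a)%N.
Proof. by move=> kt; rewrite rcolE // lt_count_geq ?lam_sorted ?subn_gt0. Qed.

Lemma rcol_mono k : (k.+1 < t)%N -> (r k <= r k.+1)%N.
Proof.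
move=> kt; rewrite !rcolE ?(ltnW kt) //; apply: sub_count => x.
by apply: leq_trans; rewrite leq_sub2l.
Qed.

Lemma sumn_lam : sumn lam = (sumn mu + sumn nu)%N.
Proof.
pose M := maxn (size mu) (size nu).
rewrite !(@sumn_part _ M) ?leq_maxl ?leq_maxr ?size_map ?size_iota //.
by rewrite -big_split /=; apply: eq_bigr => a _; rewrite part_lam.
Qed.

(** The boxes of the diagram, counted by columns and by rows. *)
Lemma dimU_tlen : dimU mu nu t = sumn lam.
Proof.
rewrite /dimU (eq_bigr (fun k : 'I_t => \sum_(x <- lam) (t - k <= x))%N); last first.
  by move=> k _; rewrite rcolE // count_sum.
rewrite exchange_big sumnE /=; apply: eq_big_seq => x /(nthP 0%N)[a _ <-].
rewrite (reindex_inj rev_ord_inj) /=.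
rewrite (eq_bigr (fun k : 'I_t => (k < part lam a) : nat)); last first.
  by move=> k _; rewrite subKn.
rewrite -(big_mkord xpredT (fun k => (k < part lam a) : nat)) -count_sum.
rewrite -[RHS](count_iota_leq (part_lam_le a)) /index_iota subn0.
by rewrite -[iota 1 t]/(iota (1 + 0) t) iotaDl count_map; apply: eq_count => k /=.
Qed.

(** By [enhI_spec] the columns indexed by [I] are those of [mu], and the number of columns longer
    than a is the part in row a. *)
Lemma cnt_mu (I : pred nat) a : enhI_spec mu nu I -> cnt r I t a = part mu a.
Proof.
move=> [rI _]; have /andP[sm _] := mu_part.
have <- : count (fun c => a < c)%N (rev (conjseq mu)) = part mu a.
  rewrite count_rev count_map -[RHS](@count_iota_leq _ (head 0%N mu)); last first.
    by rewrite -nth0; apply: part_le.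
  apply: eq_in_count => j; rewrite mem_iota => /andP[j0 _] /=.
  by rewrite lt_count_geq.
rewrite -rI count_map count_filter count_sum /cnt.
rewrite -(big_mkord xpredT (fun j => (I j && (a < r j)%N) : nat)).
rewrite /index_iota subn0; apply: eq_bigr => j _ /=.
by rewrite andbC.
Qed.

End Partitions.

(** * The enhanced orbit as the orbit of the standard point *)

Section OrbitIsStandard.
Variables (C : numClosedFieldType) (mu nu : seq nat) (I : pred nat) (t' : nat).
Hypotheses (mu_part : is_partition mu) (nu_part : is_partition nu).
Hypotheses (tE : tlen mu nu = t'.+1) (specI : enhI_spec mu nu I).
Let t := t'.+1.
Local Notation lam := (lamseq mu nu).
Local Notation r := (rcol mu nu).
Local Notation d := (dimr r).
Local Notation blk := (blk r t').
Local Notation row_of := (row_of r t').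
Local Notation stdN := (stdN r t' C).
Local Notation stdu := (stdu r t' I C).

Let r_mono i : (i.+1 < t)%N -> (r i <= r i.+1)%N.
Proof. by rewrite /t -tE; apply: rcol_mono. Qed.

Let lt_r k a : (k < t)%N -> (a < r k)%N = (t - k <= part lam a)%N.
Proof. by rewrite /t -tE; apply: lt_rcol. Qed.

Let lam_t a : (part lam a <= t)%N.
Proof. by rewrite /t -tE part_lam_le. Qed.

Let cntE a : cnt r I t a = part mu a.
Proof. by rewrite /t -tE cnt_mu. Qed.

Let mu_lam a : (part mu a <= part lam a)%N.
Proof. by rewrite part_lam leq_addr. Qed.

(** The vector e_(a, j) of U_t; the formula yields 0 at j = 0, in line with the convention e_(a, 0)
    = 0. *)
Definition jvec a j : 'cV[C]_(d t) :=
  \col_p ((row_of p == a) && (blk p + j == t)%N)%:R.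

Lemma jvec0 a : jvec a 0 = 0.
Proof.
apply/matrixP => p k; rewrite !mxE addn0.
by have /ltn_eqF -> := blk_lt (leqnn t) (ltn_ord p); rewrite andbF.
Qed.

Lemma jvec_delta a j : (0 < j <= part lam a)%N ->
  exists2 p : 'I_(d t), p = (d (t - j) + a)%N :> nat & jvec a j = delta_mx p 0.
Proof.
move=> /andP[j0 ja]; have jt := leq_trans ja (lam_t a).
have kt : (t - j < t)%N by rewrite ltn_subrL j0.
have ar : (a < r (t - j))%N by rewrite lt_r // subKn.
exists (Ordinal (pos_lt kt ar)) => //; apply/matrixP => p k.
rewrite !mxE ord1 andbT; congr ((nat_of_bool _)%:R).
apply/andP/eqP => [[/eqP rp /eqP bp]|->] /=; last first.
  by rewrite blk_pos ?row_pos // subnK.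
have kE : blk p = (t - j)%N by rewrite -(addnK j (blk p)) bp.
apply: val_inj; rewrite /= -kE -rp.
by apply: blk_row; apply: ltn_ord.
Qed.

Lemma delta_jvec (p : 'I_(d t)) :
  (0 < t - blk p <= part lam (row_of p))%N /\
  delta_mx p 0 = jvec (row_of p) (t - blk p).
Proof.
have bt := blk_lt (leqnn t) (ltn_ord p).
have jp : (0 < t - blk p <= part lam (row_of p))%N.
  by rewrite subn_gt0 bt -lt_r // row_lt.
split=> //; have [q qE ->] := jvec_delta jp.
congr delta_mx; apply: val_inj; rewrite /= qE subKn ?(ltnW bt) //.
by apply: blk_row; apply: ltn_ord.
Qed.

Lemma stdN_jvec a j : (0 < j <= part lam a)%N -> stdN *m jvec a j = jvec a j.-1.
Proof.
move=> ja; have [q qE ->] := jvec_delta ja; case: j ja qE => // -[|j] ja qE.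
  (* For j = 1 the position lies in the last block, where the columns of [stdN] are zero. *)
  rewrite jvec0 -colE; apply/matrixP => p k; rewrite [LHS]mxE stdN_shift mxE.
  by rewrite qE subn1 /= ltnNge leq_addr andbF.
have ja' : (0 < j.+1 <= part lam a)%N by case/andP: ja => _ /ltnW.
have [p pE ->] := jvec_delta ja'.
have jt : (j.+2 <= t)%N by case/andP: ja => _ /leq_trans; apply.
have kt : (t - j.+2 < t')%N by rewrite -ltnS -/t -subSn // subSS ltn_subrL.
have ar : (a < r (t - j.+2))%N.
  have kt2 : (t - j.+2 < t)%N := ltnW kt.
  by rewrite lt_r ?subKn //; case/andP: ja.
apply: stdN_delta => //; first by rewrite qE pos_lt.
by rewrite qE shift_surj // pE -subSn.
Qed.

Lemma stdu_jvec : stdu t =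
  \sum_(a < size lam | (0 < part mu a)%N) jvec a (part mu a).
Proof.
apply/matrixP => p k; rewrite summxE !mxE cntE big_mkcond /=.
rewrite (eq_bigr (fun a : 'I_(size lam) => (row_of p == a :> nat)%:R *
   ((0 < part mu a)%N && (blk p + part mu a == t)%N)%:R)); last first.
  move=> a _; rewrite mxE -natrM mulnb; case: (0 < _)%N => /=; last by rewrite andbF.
  by [].
rewrite (sum_ord_delta _ (fun a => ((0 < part mu a)%N && (blk p + part mu a == t)%N)%:R)).
have bt := blk_lt (leqnn t) (ltn_ord p).
rewrite -natrM mulnb eq_sym; congr ((nat_of_bool _)%:R).
case: eqP => [E|_]; last by rewrite !andbF.
have m0 : (0 < part mu (row_of p))%N.
  by rewrite -(ltn_add2l (blk p)) addn0 E.
rewrite m0 !andbT ltnNge; symmetry; apply/negP => sz.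
by have := leq_trans m0 (mu_lam _); rewrite /part nth_default.
Qed.

Lemma dim_lam : d t = sumn lam.
Proof. by rewrite -(dimU_tlen mu_part nu_part) tE. Qed.

Lemma size_jordan_seq (e : nat -> nat -> 'cV[C]_(d t)) :
  size [seq e i j | i <- iota 0 (size lam), j <- iota 1 (part lam i)] = d t.
Proof.
rewrite size_allpairs_dep dim_lam; congr sumn.
rewrite (eq_map (fun i => size_iota 1 (part lam i))).
by rewrite -[RHS](mkseq_nth 0%N).
Qed.

Lemma mem_jordan_seq (e : nat -> nat -> 'cV[C]_(d t)) a j :
  (0 < j <= part lam a)%N ->
  e a j \in [seq e i j | i <- iota 0 (size lam), j <- iota 1 (part lam i)].
Proof.
move=> /andP[j0 ja]; apply/allpairsPdep; exists a, j; split=> //.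
  rewrite mem_iota /= ltnNge; apply/negP => sz.
  by have := leq_trans j0 ja; rewrite /part nth_default.
by rewrite mem_iota j0 add1n ltnS.
Qed.

Lemma mulmx_delta_sum m (M : 'M[C]_(m, d t)) (c : 'cV_(d t)) :
  M *m c = \sum_p c p 0 *: (M *m delta_mx p 0).
Proof.
rewrite [c in LHS](_ : c = \sum_p c p 0 *: delta_mx p 0).
  by rewrite mulmx_sumr; apply: eq_bigr => p _; rewrite scalemxAr.
apply/matrixP => p j; rewrite ord1 summxE (bigD1 p) //= !mxE !eqxx mulr1.
by rewrite big1 ?addr0 // => q ne; rewrite !mxE eq_sym (negPf ne) mulr0.
Qed.

Lemma mulmx_delta_inj m (M M' : 'M[C]_(m, d t)) :
  (forall p, M *m delta_mx p 0 = M' *m delta_mx p 0 :> 'cV_m) -> M = M'.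
Proof.
move=> MM'; apply/matrixP => i p; have /matrixP/(_ i 0) := MM' p.
by rewrite -!colE !mxE.
Qed.

(** The matrix whose columns are the given Jordan basis, listed by position, carries the standard
    point to [p]; conversely an invertible [T] carries the [jvec] to such a basis. *)
Lemma enh_orbit_std (p : VEnd C (d t)) :
  enh_orbit mu nu p <-> std_orbit I p.
Proof.
split=> [[e [eB e0 eX ev]]|[T TU ->]]; last first.
  exists (fun a j => T *m jvec a j); split.
  (* The family has as many members as the dimension, so spanning suffices. *)
  - rewrite basisEdim size_jordan_seq dimvf /dim /= muln1 leqnn andbT.
    apply/subvP => v _; rewrite -[v](mulKVmx TU) mulmx_delta_sum.
    apply: memv_suml => q _; apply: memvZ; apply: memv_span.
    by have [jq ->] := delta_jvec q; apply: mem_jordan_seq.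
  - by move=> a _; rewrite jvec0 mulmx0.
  - by move=> a j _ ja /=; rewrite mulmxA mulmxKV // -(mulmxA T) stdN_jvec.
  - by rewrite /= stdu_jvec mulmx_sumr.
pose T : 'M[C]_(d t) := \matrix_(k, q) e (row_of q) (t - blk q)%N k 0.
have Te a j : (0 < j <= part lam a)%N -> T *m jvec a j = e a j.
  move=> ja; have [q qE ->] := jvec_delta ja.
  rewrite -colE; apply/matrixP => k l; rewrite !mxE ord1 qE.
  case/andP: ja => j0 ja; have jt := leq_trans ja (lam_t a).
  have kt : (t - j < t)%N by rewrite ltn_subrL j0.
  have ar : (a < r (t - j))%N by rewrite lt_r // subKn.
  by rewrite blk_pos ?row_pos // subKn.
have lam_size a j : (0 < j <= part lam a)%N -> (a < size lam)%N.
  move=> /andP[j0 ja]; rewrite ltnNge; apply/negP => sz.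
  by have := leq_trans j0 ja; rewrite /part nth_default.
have TU : T \in unitmx.
  (* Spanning makes [T] surjective, and preimages of the unit vectors form a right inverse. *)
  have surj (v : 'cV_(d t)) : exists c, T *m c = v.
    have : v \in limg (linfun (mulmx T : 'cV_(d t) -> 'cV_(d t))).
      have : (fullv <= limg (linfun (mulmx T : 'cV_(d t) -> 'cV_(d t))))%VS.
        rewrite -[X in (X <= _)%VS](span_basis eB); apply/span_subvP => _ /allpairsPdep[a [j [_ + ->]]].
        rewrite mem_iota add1n ltnS => /Te <-.
        rewrite -[T *m _](lfunE (mulmx T)); apply: memv_img; exact: memvf.
      by move/subvP; apply; apply: memvf.
    by move=> /memv_imgP[c _ ->]; exists c; rewrite lfunE.
  have [M ME] := fin_all_exists (fun q => surj (delta_mx q 0)).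
  suff TM : T *m (\matrix_(k, q) M q k 0) = 1%:M by have [] := mulmx1_unit TM.
  apply: mulmx_delta_inj => q; rewrite -mulmxA -colE mul1mx -ME; congr (_ *m _).
  by apply/matrixP => k l; rewrite !mxE ord1.
exists T => //; case: p eX ev => v X /= eX ev; congr (_, _).
  rewrite ev stdu_jvec mulmx_sumr; apply: eq_bigr => a a0.
  by rewrite Te // a0 mu_lam.
have XT : X *m T = T *m stdN.
  apply: mulmx_delta_inj => q; have [jq ->] := delta_jvec q.
  rewrite -(mulmxA X) -(mulmxA T) Te // stdN_jvec // eX ?(lam_size _ _ jq) //.
  case E: (t - blk q)%N jq => [|[|j]] jq //=.
    by rewrite jvec0 mulmx0 e0 // (lam_size _ _ jq).
  by rewrite Te //; case/andP: jq => _ /ltnW.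
by rewrite -XT mulmxK.
Qed.

End OrbitIsStandard.

Theorem theorem4p11 (R : realType) (n : nat) (mu nu : seq nat) (I : pred nat) :
  (1 <= n)%N ->
  is_bipartition n mu nu ->
  enhI_spec mu nu I ->
  normal_var (@Lam_coord R[i] (dimU mu nu)) (@Lambda R[i] mu nu I) ->
  normal_var (@VEnd_coord R[i] n)
    (zclosure (@VEnd_coord R[i] n) (@enh_orbit R[i] n mu nu)).
Proof.
move=> n0 [mu_part nu_part nE] specI.
have dE := dimU_tlen mu_part nu_part.
rewrite sumn_lam nE in dE.
rewrite /Lambda; case tE: (tlen mu nu) dE => [|t'] dE.
  by move: n0; rewrite -dE /dimU big_ord0.
(* Substituting the dimension of U_t for [n] places the orbit in the space of the quiver projection
   without casts. *)
case: n / dE {n0 nE} => nL.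
have -> : @enh_orbit R[i] (dimU mu nu t'.+1) mu nu = @std_orbit (rcol mu nu) t' I R[i].
  by apply: funext => p; apply: propext; apply: enh_orbit_std.
apply: normal_std_orbit nL => i it.
by apply: rcol_mono; rewrite tE.
Qed.
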